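(* Let $\ell_1\in\mathbb{R}$ with $\ell_1\le 2m_0$. Assume that there exist $C>0$, $k_0>0$ and $T>0$ such that $$\mathcal{E}_{\ell_1}(u^k)\le C\int_0^T\|\mathsf{L}u^k(t)\|_K^2\,dt$$ holds for every $U=(u^k)_{k\in\mathbb{Z}^*}\in B$ and every $k\in\mathbb{Z}^*$ with $|k|\ge k_0$. Assume moreover the following unique continuation property: if $v$ is an eigenvector of $\mathsf{A}$ such that $\mathsf{L}v=0$, then $v=0$ (i.e. no eigenvector of $\mathsf{A}$ is annihilated by $\mathsf{L}$). Then for every $T'>T$ there exists $C'>0$ such that for every $(\underline{u}^0,\underline{u}^1)\in D(\mathsf{A}^{m_0})\times D(\mathsf{A}^{m_0-1/2})$ the solution $u$ of $\partial_t^2u+\mathsf{A}u=0$, $u|_{t=0}=\underline{u}^0$, $\partial_tu|_{t=0}=\underline{u}^1$, satisfies $$\mathcal{E}_{\ell_1}(u)\le C'\int_0^{T'}\|\mathsf{L}u(t)\|_K^2\,dt.$$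
   Context: Let $E$ be a (complex) Hilbert space and $\mathsf{A}$ a positive unbounded selfadjoint operator on $E$ with dense domain. Assume there is a real Hilbert basis $(e_\nu)_{\nu\in\mathbb{N}}$ of $E$ made of eigenvectors of $\mathsf{A}$, associated with a nondecreasing sequence of eigenvalues $\lambda_\nu>0$, $\lambda_\nu\to+\infty$. Write $u=\sum_\nu u_\nu e_\nu$, $u_\nu=(u,e_\nu)_E$. For $s\ge0$, $D(\mathsf{A}^s)=\{u\in E: (\lambda_\nu^su_\nu)_\nu\in\ell^2(\mathbb{C})\}$; for $s<0$, $D(\mathsf{A}^s)$ is the dual of $D(\mathsf{A}^{|s|})$ with $E$ as pivot space, its elements being the series $u=\sum_\nu u_\nu e_\nu$ with $(\lambda_\nu^su_\nu)_\nu\in\ell^2(\mathbb{C})$. In all cases $\mathsf{A}^su=\sum_\nu\lambda_\nu^su_\nu e_\nu$ and $\|u\|_{D(\mathsf{A}^s)}^2=\|\mathsf{A}^su\|_E^2=\sum_\nu\lambda_\nu^{2s}|u_\nu|^2$. Wave equation: for $s\in\mathbb{R}$, $\underline{u}^0\in D(\mathsf{A}^{s/2})$, $\underline{u}^1\in D(\mathsf{A}^{(s-1)/2})$, the equation $\partial_t^2u+\mathsf{A}u=0$, $u|_{t=0}=\underline{u}^0$, $\partial_tu|_{t=0}=\underline{u}^1$ has the unique solution $u\in\bigcap_{k\in\mathbb N}\mathscr{C}^k(\mathbb{R};D(\mathsf{A}^{(s-k)/2}))$, $$u(t)=\sum_\nu\big(e^{it\sqrt{\lambda_\nu}}u_\nu^++e^{-it\sqrt{\lambda_\nu}}u_\nu^-\big)e_\nu,\quad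 u_\nu^\pm=\tfrac12\big(\underline{u}^0_\nu\mp i\underline{u}^1_\nu/\sqrt{\lambda_\nu}\big).$$ Its energy $\mathcal{E}_s(u)=\frac12\big(\|u(t)\|^2_{D(\mathsf{A}^{s/2})}+\|\partial_tu(t)\|^2_{D(\mathsf{A}^{(s-1)/2})}\big)=\sum_\nu\lambda_\nu^s(|u_\nu^+|^2+|u_\nu^-|^2)$ is independent of $t$. Dyadic decomposition: fix $0<\alpha<1$ and $\rho\in\,]1,1/\alpha[$. For $k\in\mathbb{Z}^*=\mathbb{Z}\setminus\{0\}$ let $J_k=\{\nu:\alpha\rho^{|k|}\le\sqrt{\lambda_\nu}<\rho^{|k|}/\alpha\}$ (a finite set) and $E_k=\mathrm{span}\{e_\nu:\nu\in J_k\}$ with the norm of $E$. An element $u=\sum_{\nu\in J_k}u_\nu e_\nu\in E_k$ is identified with the solution of the wave equation $u(t)=\sum_{\nu\in J_k}e^{\mathrm{sgn}(k)it\sqrt{\lambda_\nu}}u_\nu e_\nu$ (so $E_k=E_{-k}$ as spaces but the sign of $k$ matters in this identification). Set $B=\{(u^k)_{k\in\mathbb{Z}^*}: u^k\in E_k,\ \|u^k\|_E\le1\}$. Observation operator: $K$ is a Hilbert space and $\mathsf{L}:E\to K$ is a possibly unbounded linear operator with domain $D(\mathsf{L})=D(\mathsf{A}^{m_0})$ for some $m_0\in\mathbb{R}$, with $\|\mathsf{L}u\|_K\le C_0\|u\|_{D(\mathsf{A}^{m_0})}$ for some constant $C_0$. *)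

(* Defs.v *)
From HB Require Import structures.
From mathcomp Require Import all_boot all_order all_algebra.
From mathcomp Require Import all_classical all_reals all_analysis.
From mathcomp Require Export complex.

Set Implicit Arguments.
Unset Strict Implicit.
Unset Printing Implicit Defensive.

Import Order.TTheory GRing.Theory Num.Theory.
Import numFieldNormedType.Exports.

Local Open Scope classical_set_scope.
Local Open Scope complex_scope.
Local Open Scope ring_scope.

Section Hilbert.
Context {R : realType}.

(* Norms on a normed module over R[i] take their values in R[i]. *)
Definition rnorm (V : normedModType R[i]) (x : V) : R := complex.Re `|x|.

Definition hilbert_norm (E : completeNormedModType R[i])
    (dot : {dot E for Num.conj}) :=
  forall u : E, `|u| ^+ 2 = dot u u.

(* An unbounded operator is a total function together with its domain D; its
   values outside D are irrelevant. *)
Definition linear_operator (V W : lmodType R[i]) (D : set V) (f : V -> W) :=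
  [/\ D 0,
      forall (a : R[i]) u v, D u -> D v -> D (a *: u + v) &
      forall (a : R[i]) u v, D u -> D v -> f (a *: u + v) = a *: f u + f v].

Section Operators.
Variables (E : completeNormedModType R[i]) (dot : {dot E for Num.conj}).

Definition selfadjoint (D : set E) (A : E -> E) :=
  forall v w : E,
    (forall u, D u -> dot (A u) v = dot u w) <-> (D v /\ w = A v).

Definition positive_operator (D : set E) (A : E -> E) :=
  forall u, D u -> 0 <= dot (A u) u.

Definition eigenvector (D : set E) (A : E -> E) (v : E) :=
  [/\ D v, v != 0 & exists mu : R[i], A v = mu *: v].

Definition coefficients (e : nat -> E) (u : E) : nat -> R[i]^o :=
  fun n => dot u (e n).

Definition hilbert_basis (e : nat -> E) :=
  (forall m n, dot (e m) (e n) = (m == n)%:R) /\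
  (forall u : E, series (fun n => coefficients e u n *: e n) @ \oo --> u).

Definition eigenbasis (D : set E) (A : E -> E) (e : nat -> E)
    (lambda : nat -> R) :=
  hilbert_basis e /\
  (forall n, [/\ D (e n), A (e n) = (lambda n)%:C *: e n & 0 < lambda n]) /\
  (forall m n, (m <= n)%N -> lambda m <= lambda n) /\
  lambda @ \oo --> +oo.

End Operators.
End Hilbert.

(* An element sum_n u_n e_n of D(A^s), s of any sign, is represented by its
   sequence of coefficients; a vector v of E is thus represented by
   [coefficients dot e v]. *)
Section Scale.
Context {R : realType}.
Variable lambda : nat -> R.

Local Notation coefs := (nat -> R[i]^o).

Definition l2norm2 (u : coefs) : \bar R :=
  (\sum_(0 <= n <oo) ((rnorm (u n)) ^+ 2)%:E)%E.

Definition powA (s : R) (u : coefs) : coefs :=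
  fun n => (lambda n `^ s)%:C * u n.

Definition DA_norm2 (s : R) (u : coefs) : \bar R := l2norm2 (powA s u).

Definition DA (s : R) : set coefs := [set u | (DA_norm2 s u < +oo)%E].

Definition DA_norm (s : R) (u : coefs) : R := Num.sqrt (fine (DA_norm2 s u)).

(* Coefficientwise time derivative. *)
Definition dt (u : R -> coefs) : R -> coefs := fun t n =>
  derive1 (fun r => complex.Re (u r n)) t
    +i* derive1 (fun r => complex.Im (u r n)) t.

Definition continuous_DA (s : R) (u : R -> coefs) :=
  forall t, DA s (u t) /\
    DA_norm2 s (u (t + h) - u t) @[h --> (0 : R)] --> 0%E.

(* The derivative exists for the norm of D(A^s); it is then [dt u], because this
   norm controls each coefficient. *)
Definition derivable_DA (s : R) (u : R -> coefs) :=
  forall t,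
    DA_norm2 s ((h^-1)%:C *: (u (t + h) - u t) - dt u t)
      @[h --> (0 : R)^'] --> 0%E.

Fixpoint Ck_DA (k : nat) (s : R) (u : R -> coefs) : Prop :=
  continuous_DA s u /\
  if k is k'.+1 then derivable_DA s u /\ Ck_DA k' s (dt u) else True.

Definition wave_solution (s : R) (u0 u1 : coefs) (u : R -> coefs) :=
  [/\ forall k : nat, Ck_DA k ((s - k%:R) / 2) u,
      forall t, dt (dt u) t + powA 1 (u t) = 0,
      u 0 = u0 &
      dt u 0 = u1].

(* Constant in t along solutions of the wave equation; [t] is the time at which
   the two norms are taken. *)
Definition energy (s : R) (u : R -> coefs) (t : R) : \bar R :=
  ((2^-1)%:E *
   (DA_norm2 (s / 2) (u t) + DA_norm2 ((s - 1) / 2) (dt u t)))%E.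

Definition expi (x : R) : R[i] := cos x +i* sin x.

(* For u in E_k the coefficients vanish outside J_k, so the sum over J_k in the
   solution attached to u needs no explicit restriction. *)
Definition half_wave (k : int) (u : coefs) : R -> coefs := fun t n =>
  expi (Num.sg k%:~R * t * Num.sqrt (lambda n)) * u n.

Definition observed (K : normedModType R[i]) (L : coefs -> K) (T : R)
    (u : R -> coefs) : \bar R :=
  (\int[lebesgue_measure]_(t in `[0%R, T]) ((rnorm (L (u t))) ^+ 2)%:E)%E.

End Scale.

Section Dyadic.
Context {R : realType}.
Variables (lambda : nat -> R) (alpha rho : R).

Definition J (k : int) : set nat :=
  [set n | alpha * rho ^+ `|k|%N <= Num.sqrt (lambda n) < rho ^+ `|k|%N / alpha].

Definition dyadic_space (E : completeNormedModType R[i]) (e : nat -> E)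
    (k : int) : set E :=
  [set u | exists c : nat -> R[i], u = \sum_(n \in J k) (c n *: e n)].

(* The index set is Z^*: the value U 0 plays no role. *)
Definition dyadic_ball (E : completeNormedModType R[i]) (e : nat -> E) :
    set (int -> E) :=
  [set U | forall k, k != 0 -> dyadic_space e k (U k) /\ rnorm (U k) <= 1].

End Dyadic.

(* Main.v *)
Require Import Defs.
From HB Require Import structures.
From mathcomp Require Import all_boot all_order all_algebra.
From mathcomp Require Import all_classical all_reals all_analysis.
From mathcomp Require Import measurable_realfun.
From mathcomp Require Import ring lra.
Import Order.TTheory GRing.Theory Num.Theory.
Import numFieldNormedType.Exports.
Local Open Scope classical_set_scope.
Local Open Scope ring_scope.

(** Waves are superpositions of modes e^(i w t) c e_n with frequencies
    w = +/- sqrt lambda_n, so the theorem is an inequality for vector-valued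
    nonharmonic Fourier series: a weighted sum of the |c|^2 is bounded by the
    integral over [0, T'] of the square norm of f(t) = sum e^(i w t) c g, where g
    is the image of e_n under L.  It is enough to treat finite sums, with a
    constant that does not depend on the number of modes
    ([full_observability]); truncating a wave then gives the general case, L
    being continuous on D(A^m0) ([observe_wave]).

    High frequencies ([high_frequency]).  Fix a polynomial p that vanishes to
    high order at both ends of [0, d].  Replacing f(t) by the integral of
    p(s) e^(-i xi s) f(t + s) over s in [0, d] multiplies the coefficient of
    frequency w by [hat p (w - xi)], which decays like a high power of w - xi.
    The new signal is thus concentrated near xi, while its values for t in
    [0, T] use f on [0, T + d] only.  Its main part lies in one dyadic block,
    on one side of 0, and is observed by hypothesis; the remainder gains as many
    powers of the frequency as wanted, which makes up for the loss between the
    energy of order l1 and the norm of D(A^m0).  When xi runs through finitely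
    many translates of (2 pi / d) Z, Bessel's inequality ([window_bessel])
    bounds the sum of all the windowed signals by the integral of |f|^2 over
    [0, T + d], every high frequency is met by some window, and the sum of the
    remainders is absorbed.

    Low frequencies ([add_frequency]).  Only finitely many frequencies remain,
    and they are put back one at a time, each for an arbitrarily small amount of
    time.  For a frequency mu, subtracting from [hat p 0] f the signal windowed at
    xi = mu removes mu and multiplies the other coefficients by factors that are
    bounded away from 0; this controls all the other modes.  The signal windowed
    at mu is then, up to these modes and with a gain of decay that again hides
    the loss, the observation of a combination v of eigenvectors of one
    eigenvalue.  Unique continuation makes L injective on that space, which has
    finite dimension, so the size of L v controls v ([free_lower_bound]).  This
    takes the place of an argument by contradiction and compactness. *)

Set Implicit Arguments.
Unset Strict Implicit.
Unset Printing Implicit Defensive.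

Local Open Scope complex_scope.
Local Notation Re := complex.Re.
Local Notation Im := complex.Im.

(** * Integrals of continuous functions over a segment *)

Section ContinuousIntegral.
Context {R : realType}.
Implicit Types (f g : R -> R) (a b c : R).

Definition cint a b f : R := (\int[lebesgue_measure]_(x in `[a, b]) f x)%R.

Lemma continuous_itv_integrable a b f : continuous f ->
  (@lebesgue_measure R).-integrable `[a, b] (EFin \o f).
Proof.
move=> cf; apply: continuous_compact_integrable; first exact: segment_compact.
exact: continuous_subspaceT.
Qed.

Lemma EFin_cint a b f : continuous f ->
  (\int[lebesgue_measure]_(x in `[a, b]) (f x)%:E = (cint a b f)%:E)%E.
Proof.
move=> cf; rewrite /cint /Rintegral fineK//.
by apply: integrable_fin_num => //; exact: continuous_itv_integrable.
Qed.

Lemma cintD a b f g : continuous f -> continuous g ->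
  cint a b (fun x => f x + g x) = cint a b f + cint a b g.
Proof.
by move=> cf cg; apply: RintegralD => //; exact: continuous_itv_integrable.
Qed.

Lemma cintZ a b c f : continuous f ->
  cint a b (fun x => c * f x) = c * cint a b f.
Proof. by move=> cf; apply: RintegralZl => //; exact: continuous_itv_integrable. Qed.

Lemma cint0 a b : cint a b (fun=> 0) = 0.
Proof. by rewrite /cint Rintegral_cst// mul0r. Qed.

Lemma continuous_addf f g : continuous f -> continuous g ->
  continuous (fun s => f s + g s).
Proof. by move=> cf cg s; apply: continuousD; [exact: cf|exact: cg]. Qed.

Lemma continuous_scale c f : continuous f -> continuous (fun s => c * f s).
Proof. by move=> cf s; apply: continuousM; [exact: cst_continuous|exact: cf]. Qed.

Lemma continuous_sumf (I : Type) (r : seq I) (P : pred I) (F : I -> R -> R) :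
  (forall i, continuous (F i)) ->
  continuous (fun x => \sum_(i <- r | P i) F i x).
Proof.
move=> cF; elim: r => [|i r ih].
  by under eq_fun do rewrite big_nil; exact: cst_continuous.
under eq_fun do rewrite big_cons.
case: (P i) => //; move=> x; apply: continuousD; [exact: cF|exact: ih].
Qed.

Lemma cint_sum a b (I : Type) (r : seq I) (P : pred I) (F : I -> R -> R) :
  (forall i, continuous (F i)) ->
  cint a b (fun x => \sum_(i <- r | P i) F i x) = \sum_(i <- r | P i) cint a b (F i).
Proof.
move=> cF; elim: r => [|i r ih].
  by rewrite big_nil -[RHS](cint0 a b); congr cint; apply/funext => x; rewrite big_nil.
rewrite big_cons -ih; case: ifPn => Pi.
  rewrite -cintD//; last exact: continuous_sumf.
  by congr cint; apply/funext => x; rewrite big_cons Pi.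
by congr cint; apply/funext => x; rewrite big_cons (negbTE Pi).
Qed.

Lemma le_cint a b f g : continuous f -> continuous g ->
  (forall x, a <= x <= b -> f x <= g x) -> cint a b f <= cint a b g.
Proof.
move=> cf cg fg; apply: le_Rintegral => //; exact: continuous_itv_integrable.
Qed.

Lemma cint_ge0 a b f : (forall x, a <= x <= b -> 0 <= f x) -> 0 <= cint a b f.
Proof. by move=> f0; apply: Rintegral_ge0 => x /=; rewrite in_itv/=; exact: f0. Qed.

Lemma ler_norm_cint a b f : continuous f ->
  `|cint a b f| <= cint a b (fun x => `|f x|).
Proof.
by move=> cf; apply: le_normr_Rintegral => //; exact: continuous_itv_integrable.
Qed.

Lemma cint_cst a b c : a <= b -> cint a b (fun=> c) = c * (b - a).
Proof.
move=> ab; rewrite /cint Rintegral_cst//= lebesgue_measure_itv/= lte_fin.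
by case: ltgtP ab => //= ->; rewrite subrr.
Qed.

Lemma cint_FTC2 a b f (F : R -> R) : a < b -> continuous f ->
  (forall x : R, is_derive x (1 : R) F (f x)) -> cint a b f = F b - F a.
Proof.
move=> ab cf dF; rewrite /cint /Rintegral (@continuous_FTC2 _ f F)//.
- exact: continuous_subspaceT.
- have cF : continuous F.
    by move=> x; apply/differentiable_continuous/derivable1_diffP.
  split.
  + by move=> x _; exact: ex_derive.
  + by apply: cvg_at_right_filter; exact: cF.
  + by apply: cvg_at_left_filter; exact: cF.
- by move=> x _; rewrite derive1E derive_val.
Qed.

Lemma cint_sub_le a b c d f : continuous f -> (forall x, 0 <= f x) ->
  a <= c -> d <= b -> cint c d f <= cint a b f.
Proof.
move=> cf f0 ac db; rewrite -lee_fin -!EFin_cint//.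
apply: ge0_subset_integral => //=.
- apply/measurable_EFinP; apply: measurable_funTS.
  exact: continuous_measurable_fun.
- by move=> x _; rewrite lee_fin.
- by apply: subset_itv; rewrite bnd_simp.
Qed.

(** By continuity f exceeds f(x0) / 2 on a small segment [x0, x0 + e/2].  The
    comparison of integrals over nested segments wants a function that is
    nonnegative everywhere, hence the positive part in the proof. *)
Lemma cint_gt0 a b f x0 : continuous f -> (forall x, a <= x <= b -> 0 <= f x) ->
  a < x0 < b -> 0 < f x0 -> 0 < cint a b f.
Proof.
move=> cf f0 /andP[ax xb] fx0.
have : \forall x \near x0, f x0 / 2 < f x /\ a < x < b.
  near=> x; split.
    near: x; have /cvgrPdist_lt/(_ (f x0 / 2)) := cf x0.
    rewrite divr_gt0//= => /(_ isT).
    apply: filterS => x; rewrite ltr_norml => /andP[_]; lra.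
  by apply/andP; split; near: x; [exact: lt_nbhsr|exact: lt_nbhsl].
move=> /nbhs_ballP[e /= e0 He].
pose g x := Num.max 0 (f x).
have cg : continuous g.
  by move=> x; apply: continuous_max; [exact: cst_continuous|exact: cf].
have -> : cint a b f = cint a b g.
  apply: eq_Rintegral => x; rewrite inE/= in_itv/= => xab.
  by rewrite /g; apply/esym/max_idPr; exact: f0.
pose d := e / 2; have d0 : 0 < d by rewrite divr_gt0.
have Hx x : x0 <= x <= x0 + d -> f x0 / 2 < f x /\ a < x < b.
  move=> /andP[h1 h2]; apply: He; rewrite /ball/= ltr_norml; apply/andP; split;
  move: h1 h2 d0 e0; rewrite /d; lra.
have h0 : a <= x0 <= b by rewrite !ltW.
apply: (@lt_le_trans _ _ (cint x0 (x0 + d) (fun=> f x0 / 2))).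
  rewrite cint_cst ?lerDl ?ltW// addrAC subrr add0r mulr_gt0// divr_gt0//.
apply: (@le_trans _ _ (cint x0 (x0 + d) g)).
  apply: le_cint => //; first exact: cst_continuous.
  by move=> x /Hx[h _]; rewrite /g le_max (ltW h) orbT.
apply: cint_sub_le => //; first by move=> x; rewrite /g le_max lexx.
  exact: ltW.
have /Hx[_ /andP[_ /ltW//]] : x0 <= x0 + d <= x0 + d by rewrite lexx lerDl ltW.
Unshelve. all: by end_near. Qed.

(** This replaces Fubini's theorem when a signal is averaged over short times:
    each short time window lies in the whole time interval. *)
Lemma cint_shift_le a b c t f : continuous f -> (forall x, 0 <= f x) ->
  0 < b -> a <= t -> t + b <= c ->
  cint 0 b (fun s => f (t + s)) <= cint a c f.
Proof.
move=> cf f0 b0 at0 tb.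
have D1 : derive1 (fun s : R => t + s) = cst 1.
  apply/funext => x; rewrite derive1E deriveD//.
  by rewrite derive_cst derive_id add0r.
have -> : cint 0 b (fun s => f (t + s)) = cint (t + 0) (t + b) f.
  congr fine; rewrite (@integration_by_substitution_increasing _ (fun s => t + s))//.
  - by apply: eq_integral => x _; rewrite D1 /= fctE mulr1.
  - exact: ltW.
  - by move=> x y _ _; rewrite ltrD2l.
  - by move=> x _; rewrite D1; exact: cst_continuous.
  - by rewrite D1; exact: is_cvg_cst.
  - by rewrite D1; exact: is_cvg_cst.
  - split.
    + by move=> x _; apply: derivableD.
    + by apply: cvgD; [exact: cvg_cst|apply: cvg_at_right_filter; exact: cvg_id].
    + by apply: cvgD; [exact: cvg_cst|apply: cvg_at_left_filter; exact: cvg_id].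
  - exact: continuous_subspaceT.
by rewrite addr0; apply: cint_sub_le.
Qed.

End ContinuousIntegral.

(** * Real and imaginary parts *)

Section Complex.
Context {R : realType}.
Implicit Types (x y : R) (z w : R[i]).

Definition csq z : R := Re z ^+ 2 + Im z ^+ 2.

Lemma cReD z w : Re (z + w) = Re z + Re w. Proof. by case: z; case: w. Qed.
Lemma cImD z w : Im (z + w) = Im z + Im w. Proof. by case: z; case: w. Qed.
Lemma cReM z w : Re (z * w) = Re z * Re w - Im z * Im w.
Proof. by case: z; case: w. Qed.
Lemma cImM z w : Im (z * w) = Re z * Im w + Im z * Re w.
Proof. by case: z; case: w. Qed.
Lemma cRe_conj z : Re (Num.conj z) = Re z. Proof. by case: z. Qed.
Lemma cIm_conj z : Im (Num.conj z) = - Im z. Proof. by case: z. Qed.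
Lemma complex_eq z w : Re z = Re w -> Im z = Im w -> z = w.
Proof. by case: z; case: w => a b c d /= -> ->. Qed.
Lemma csq_ge0 z : 0 <= csq z. Proof. by rewrite addr_ge0 ?sqr_ge0. Qed.
Lemma csqM z w : csq (z * w) = csq z * csq w.
Proof. by rewrite /csq cReM cImM; ring. Qed.
Lemma csqD z w : csq (z + w) <= 2 * csq z + 2 * csq w.
Proof.
rewrite /csq cReD cImD.
have := sqr_ge0 (Re z - Re w); have := sqr_ge0 (Im z - Im w); nra.
Qed.
Lemma rnorm_csq (z : R[i]^o) : rnorm z ^+ 2 = csq z.
Proof.
by rewrite /rnorm normc_def /= sqr_sqrtr ?addr_ge0 ?sqr_ge0.
Qed.
Lemma csq_real x : csq x%:C = x ^+ 2.
Proof. by rewrite /csq /= expr0n addr0. Qed.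
Lemma csqN1 : csq (-1 : R[i]) = 1.
Proof. by rewrite /csq /= oppr0 expr0n addr0 sqrrN expr1n. Qed.
Lemma csq_expi x : csq (expi x) = 1.
Proof. exact: cos2Dsin2. Qed.
Lemma expi0 : expi (0 : R) = 1.
Proof. by rewrite /expi cos0 sin0. Qed.
Lemma expiD x y : expi (x + y) = expi x * expi y.
Proof. by apply: complex_eq; rewrite /= ?cosD ?sinD ?cReM ?cImM /=; ring. Qed.
Lemma expiN x : expi (- x) = Num.conj (expi x).
Proof. by apply: complex_eq; rewrite ?cRe_conj ?cIm_conj/= ?cosN ?sinN. Qed.
Lemma mulC_conj z : z * Num.conj z = (csq z)%:C.
Proof. by apply: complex_eq; rewrite ?cReM ?cImM cRe_conj cIm_conj /csq/=; ring. Qed.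
End Complex.

(** * Fourier transform of polynomial windows *)

Section Transform.
Context {R : realType}.
Variable d : R.
Hypothesis d0 : 0 < d.
Implicit Types (p q : {poly R}) (x s : R) (z : R[i]).

Lemma continuous_horner p : continuous (horner p).
Proof.
by move=> x; apply/differentiable_continuous/derivable1_diffP/derivable_horner.
Qed.

Lemma is_derive_horner p s : is_derive s (1 : R) (horner p) p^`().[s].
Proof.
by apply: DeriveDef; [exact: derivable_horner|rewrite -derive1E -derivE].
Qed.

Lemma is_derive_sinM x s :
  is_derive s (1 : R) (fun s => sin (x * s)) (x * cos (x * s)).
Proof.
have -> : (fun s => sin (x * s)) = sin \o ( *%R x) by [].
by apply: is_derive_eq; rewrite /GRing.scale/= mulr1 mulrC.
Qed.

Lemma is_derive_cosM x s :
  is_derive s (1 : R) (fun s => cos (x * s)) (- x * sin (x * s)).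
Proof.
have -> : (fun s => cos (x * s)) = cos \o ( *%R x) by [].
by apply: is_derive_eq; rewrite /GRing.scale/= mulr1 mulrC mulrN mulNr.
Qed.

Lemma continuous_cosM x : continuous (fun s => cos (x * s)).
Proof.
by move=> s; apply/differentiable_continuous/derivable1_diffP;
   have [] := is_derive_cosM x s.
Qed.

Lemma continuous_sinM x : continuous (fun s => sin (x * s)).
Proof.
by move=> s; apply/differentiable_continuous/derivable1_diffP;
   have [] := is_derive_sinM x s.
Qed.

(** [hat p x] is the integral of p(s) e^(i x s) over [0, d]: the factor by which
    the window p multiplies a mode at distance x from its centre. *)
Definition hatc p x := cint 0 d (fun s => p.[s] * cos (x * s)).
Definition hats p x := cint 0 d (fun s => p.[s] * sin (x * s)).
Definition hat p x : R[i] := hatc p x +i* hats p x.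

Lemma continuous_pcos p x : continuous (fun s => p.[s] * cos (x * s)).
Proof.
by move=> s; apply: continuousM; [exact: continuous_horner|exact: continuous_cosM].
Qed.
Lemma continuous_psin p x : continuous (fun s => p.[s] * sin (x * s)).
Proof.
by move=> s; apply: continuousM; [exact: continuous_horner|exact: continuous_sinM].
Qed.

Lemma ReM_pexpi p x z s : Re (p.[s]%:C * expi (x * s) * z) =
  Re z * (p.[s] * cos (x * s)) + (- Im z) * (p.[s] * sin (x * s)).
Proof. by rewrite !cReM cImM /=; ring. Qed.

Lemma continuous_Re_expi p x z :
  continuous (fun s => Re (p.[s]%:C * expi (x * s) * z)).
Proof.
rewrite (funext (ReM_pexpi p x z)).
apply: continuous_addf; apply: continuous_scale.
  exact: continuous_pcos.
exact: continuous_psin.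
Qed.

Lemma cint_Re_expi p x z :
  cint 0 d (fun s => Re (p.[s]%:C * expi (x * s) * z)) = Re (hat p x * z).
Proof.
rewrite (funext (ReM_pexpi p x z)).
rewrite cintD; first last.
- by apply: continuous_scale; exact: continuous_psin.
- by apply: continuous_scale; exact: continuous_pcos.
rewrite !cintZ; [|exact: continuous_psin|exact: continuous_pcos].
by rewrite cReM /= /hatc /hats; ring.
Qed.

(* w vanishes exactly at the two ends of [0, d]; so do its powers, to high
   order. *)
Let w : {poly R} := 'X * (d%:P - 'X).

(** Integration by parts; each one gains a factor 1/x. *)
Let hat_parts p x : x != 0 -> p.[0] = 0 -> p.[d] = 0 ->
  hatc p x = - x^-1 * hats p^`() x /\ hats p x = x^-1 * hatc p^`() x.
Proof.
move=> x0 p0 pd; split.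
- have := @cint_FTC2 _ 0 d (fun s => p.[s] * cos (x * s) + x^-1 * (p^`().[s] * sin (x * s)))
    (fun s => p.[s] * (x^-1 * sin (x * s))) d0.
  rewrite p0 pd !mul0r subrr cintD; last 2 first.
  + exact: continuous_pcos.
  + by apply: continuous_scale; exact: continuous_psin.
  rewrite cintZ; last exact: continuous_psin.
  move=> H; rewrite mulNr; apply/eqP; rewrite -addr_eq0; apply/eqP; apply: H.
    apply: continuous_addf; first exact: continuous_pcos.
    by apply: continuous_scale; exact: continuous_psin.
  move=> s; have h1 := is_derive_horner p s; have h2 := is_derive_sinM x s.
  apply: is_derive_eq; rewrite /GRing.scale/= ; field.
  done.
- have := @cint_FTC2 _ 0 d (fun s => p.[s] * sin (x * s) + (- x^-1) * (p^`().[s] * cos (x * s)))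
    (fun s => p.[s] * (- x^-1 * cos (x * s))) d0.
  rewrite p0 pd !mul0r subrr cintD; last 2 first.
  + exact: continuous_psin.
  + by apply: continuous_scale; exact: continuous_pcos.
  rewrite cintZ; last exact: continuous_pcos.
  move=> H; apply/eqP; rewrite -subr_eq0 -mulNr; apply/eqP; apply: H.
    apply: continuous_addf; first exact: continuous_psin.
    by apply: continuous_scale; exact: continuous_pcos.
  move=> s; have h1 := is_derive_horner p s; have h2 := is_derive_cosM x s.
  apply: is_derive_eq; rewrite /GRing.scale/= ; field.
  done.
Qed.

Let hat_bounded p : exists2 C, 0 <= C & forall x, `|hatc p x| <= C /\ `|hats p x| <= C.
Proof.
exists (cint 0 d (fun s => `|p.[s]|)); first by apply: cint_ge0.
have cp : continuous (fun s => `|p.[s]|).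
  by move=> s; apply: continuous_comp; [exact: continuous_horner|exact: norm_continuous].
have cn (f : R -> R) : continuous f -> continuous (fun s => `|f s|).
  by move=> cf s; apply: continuous_comp; [exact: cf|exact: norm_continuous].
move=> x; split.
- apply: (le_trans (ler_norm_cint 0 d (@continuous_pcos p x))).
  apply: le_cint => //; first by apply: cn; exact: continuous_pcos.
  by move=> s _; rewrite normrM ler_piMr// cos_max.
- apply: (le_trans (ler_norm_cint 0 d (@continuous_psin p x))).
  apply: le_cint => //; first by apply: cn; exact: continuous_psin.
  by move=> s _; rewrite normrM ler_piMr// sin_max.
Qed.

(** Induction on N: the derivative of w^(N+1) q is again a multiple of w^N, so
    that N integrations by parts leave no boundary term. *)
Let hat_decay_aux N : forall q, exists2 C, 0 <= C & forall x,
  `|x| ^+ N * `|hatc (w ^+ N * q) x| <= C /\ `|x| ^+ N * `|hats (w ^+ N * q) x| <= C.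
Proof.
elim: N => [|N ih] q.
  have [C C0 hC] := hat_bounded (w ^+ 0 * q).
  by exists C => // x; rewrite !expr0 !mul1r; have := hC x; rewrite expr0 mul1r.
pose q' := (N.+1%:R)%:P * w^`() * q + w * q^`().
have dE : (w ^+ N.+1 * q)^`() = w ^+ N * q'.
  rewrite derivM deriv_exp -mulr_natr /q' exprS; rewrite -polyC_natr/=; ring.
have [C C0 hC] := ih q'.
have r0 : (w ^+ N.+1 * q).[0] = 0.
  have w0 : w.[0] = 0 by rewrite /w !hornerE ?mul0r.
  by rewrite hornerM horner_exp w0 expr0n mul0r.
have rd : (w ^+ N.+1 * q).[d] = 0.
  have wd : w.[d] = 0 by rewrite /w !hornerE ?subrr ?mulr0.
  by rewrite hornerM horner_exp wd expr0n mul0r.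
exists C => // x.
have [->|x0] := eqVneq x 0; first by rewrite normr0 expr0n/= !mul0r.
have [-> ->] := hat_parts x0 r0 rd.
have [h1 h2] := hC x; rewrite dE !normrM normrN normfV.
have K (a : R) : `|x| ^+ N.+1 * (`|x|^-1 * a) = `|x| ^+ N * a.
  by rewrite exprSr; field; rewrite normr_eq0.
by rewrite !K.
Qed.

Definition window N : {poly R} := w ^+ N.

Lemma window_ge0 N s : 0 <= s <= d -> 0 <= (window N).[s].
Proof.
move=> /andP[s0 sd]; rewrite horner_exp exprn_ge0// /w !hornerE mulr_ge0//; lra.
Qed.

Lemma window_gt0 N s : 0 < s < d -> 0 < (window N).[s].
Proof.
move=> /andP[s0 sd]; rewrite horner_exp exprn_gt0// /w !hornerE mulr_gt0//; lra.
Qed.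

Lemma window_le1 N s : d <= 1 -> 0 <= s <= d -> (window N).[s] <= 1.
Proof.
move=> d1 /andP[s0 sd]; rewrite horner_exp exprn_ile1// /w !hornerE; first by nra.
by rewrite mulr_ile1//; lra.
Qed.

(** The bounds for x near 0 and for x large are merged into one that holds
    everywhere. *)
Lemma hat_window_decay N : exists2 C, 0 <= C & forall x,
  (1 + `|x|) ^+ (N * 2) * csq (hat (window N) x) <= C.
Proof.
have [C1 C10 h1] := hat_bounded (window N).
have [C2 C20 h2] := hat_decay_aux N 1.
pose C := 2 ^+ N * (C1 + C2).
have K x (a b : R) : 0 <= a -> a <= C1 -> `|x| ^+ N * a <= C2 ->
    ((1 + `|x|) ^+ N * a) ^+ 2 <= C ^+ 2.
  move=> a0 a1 a2.
  have hx : (1 + `|x|) ^+ N <= 2 ^+ N * (1 + `|x| ^+ N).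
    have [x1|x1] := leP `|x| 1.
      apply: (@le_trans _ _ (2 ^+ N)).
        by rewrite lerXn2r ?nnegrE ?addr_ge0//; lra.
      by rewrite ler_peMr ?exprn_ge0// lerDl exprn_ge0.
    apply: (@le_trans _ _ (2 ^+ N * `|x| ^+ N)).
      by rewrite -exprMn lerXn2r ?nnegrE ?addr_ge0 ?mulr_ge0//; lra.
    by rewrite ler_pM2l ?exprn_gt0// lerDr.
  rewrite lerXn2r ?nnegrE ?mulr_ge0 ?exprn_ge0 ?addr_ge0//.
  apply: (@le_trans _ _ (2 ^+ N * (1 + `|x| ^+ N) * a)).
    by rewrite ler_wpM2r.
  by rewrite -mulrA ler_pM2l ?exprn_gt0// mulrDl mul1r lerD.
exists (C ^+ 2 + C ^+ 2); first by rewrite addr_ge0 ?sqr_ge0.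
move=> x; have [a1 a2] := h1 x; have := h2 x; rewrite mulr1 => -[b1 b2].
have := K x _ 0 (normr_ge0 _) a1 b1; have := K x _ 0 (normr_ge0 _) a2 b2.
rewrite !exprMn !real_normK ?num_real// -exprM /csq /= mulrDr => *.
by apply: lerD.
Qed.

Lemma hat_window0_gt0 N : 0 < hatc (window N) 0.
Proof.
apply: (@cint_gt0 _ _ _ _ (d / 2)).
- exact: continuous_pcos.
- by move=> s sd; rewrite mul0r cos0 mulr1 window_ge0.
- by apply/andP; split; move: d0; lra.
- by rewrite mul0r cos0 mulr1 window_gt0//; apply/andP; split; move: d0; lra.
Qed.

Lemma hat_window0 N : hat (window N) 0 = (hatc (window N) 0)%:C.
Proof.
apply: complex_eq => //=; rewrite /hats -[RHS](cint0 0 d).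
by congr cint; apply/funext => s; rewrite mul0r sin0 mulr0.
Qed.

(** The phase x s stays in [-1, 1], where the cosine is at least cos 1, so there is
    no cancellation in the real part. *)
Lemma hat_window_lower N x : `|x| * d <= 1 ->
  (cos 1 * hatc (window N) 0) ^+ 2 <= csq (hat (window N) x).
Proof.
move=> xd; have h : cos 1 * hatc (window N) 0 <= hatc (window N) x.
  rewrite /hatc -cintZ; last exact: continuous_pcos.
  apply: le_cint.
  - by apply: continuous_scale; exact: continuous_pcos.
  - exact: continuous_pcos.
  move=> s sd; rewrite mul0r cos0 mulr1 mulrC ler_wpM2l ?window_ge0//.
  have y1 : `|x * s| <= 1.
    apply: le_trans xd; case/andP: sd => s0 sd.
    by rewrite normrM ler_wpM2l// ger0_norm.
  rewrite -(cos_norm (x * s)).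
  have pi1 : (1 : R) <= pi by have := pi_ge2 R; lra.
  have [->//|ne] := eqVneq `|x * s| 1.
  have h1 : `|x * s| \in `[0, pi] by rewrite in_itv/= normr_ge0 (le_trans y1).
  have h2 : (1 : R) \in `[0, pi] by rewrite in_itv/= ler01.
  by apply/ltW; rewrite ltr_cos// lt_neqAle ne.
have p0 : 0 <= cos 1 * hatc (window N) 0.
  by rewrite mulr_ge0// ltW// ?hat_window0_gt0// cos1_gt0.
rewrite /csq /= (@le_trans _ _ (hatc (window N) x ^+ 2))//.
  by rewrite lerXn2r ?nnegrE// (le_trans p0).
by rewrite lerDl sqr_ge0.
Qed.

(** The real part is strictly smaller than at 0, because cos (x s) < 1 for small
    s > 0. *)
Lemma hat_window_neq N x : x != 0 -> 0 < csq ((hatc (window N) 0)%:C - hat (window N) x).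
Proof.
move=> x0.
have h : 0 < hatc (window N) 0 - hatc (window N) x.
  rewrite -mulN1r -cintZ; last exact: continuous_pcos.
  rewrite -cintD; last 2 first.
  - exact: continuous_pcos.
  - by apply: continuous_scale; exact: continuous_pcos.
  pose s0 := Num.min (d / 2) `|x|^-1.
  have xp : 0 < `|x| by rewrite normr_gt0.
  have s0p : 0 < s0 by rewrite lt_min divr_gt0//= invr_gt0.
  have s0d : s0 < d by rewrite /s0 gt_min; apply/orP; left; move: d0; lra.
  apply: (@cint_gt0 _ _ _ _ s0).
  - apply: continuous_addf; first exact: continuous_pcos.
    by apply: continuous_scale; exact: continuous_pcos.
  - move=> s sd; rewrite mul0r cos0 mulr1 mulN1r subr_ge0 ler_piMr ?cos_le1//.
    exact: window_ge0.
  - by rewrite s0p.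
  - rewrite mul0r cos0 mulr1 mulN1r subr_gt0 gtr_pMr; last by rewrite window_gt0// s0p.
    rewrite -(cos_norm (x * s0)) -[X in _ < X](@cos0 R).
    have xs : 0 < `|x * s0| by rewrite normr_gt0 mulf_neq0// gt_eqF.
    have xs1 : `|x * s0| <= 1.
      rewrite normrM (gtr0_norm s0p) -ler_pdivlMl// mulr1.
      by rewrite /s0 ge_min lexx orbT.
    have pi1 : (1 : R) <= pi by have := pi_ge2 R; lra.
    have h1 : `|x * s0| \in `[0, pi] by rewrite in_itv/= normr_ge0 (le_trans xs1).
    have h2 : (0 : R) \in `[0, pi] by rewrite in_itv/= lexx pi_ge0.
    by rewrite ltr_cos.
rewrite /csq cReD /= [X in X + _](_ : _ = (hatc (window N) 0 - hatc (window N) x) ^+ 2)//.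
by rewrite ltr_wpDr ?sqr_ge0// exprn_gt0.
Qed.

Let horner1 s : (1 : {poly R}).[s] = 1. Proof. exact: hornerC. Qed.

Lemma hat_one0 : hat 1 0 = d%:C.
Proof.
apply: complex_eq => /=.
- rewrite /hatc -[RHS]mul1r -[X in _ * X]subr0 -cint_cst ?ltW//.
  by congr cint; apply/funext => s; rewrite mul0r cos0 mulr1 horner1.
- rewrite /hats -[RHS](cint0 0 d).
  by congr cint; apply/funext => s; rewrite mul0r sin0 mulr0.
Qed.

Lemma sin_2pin (n : nat) : sin (2 * pi * n%:R) = 0 :> R.
Proof.
by rewrite mulr_natr -[_ *+ n]add0r mulr_natl periodicn ?sin0//; exact: sinD2pi.
Qed.
Lemma cos_2pin (n : nat) : cos (2 * pi * n%:R) = 1 :> R.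
Proof.
by rewrite mulr_natr -[_ *+ n]add0r mulr_natl periodicn ?cos0//; exact: cosD2pi.
Qed.

(** Orthogonality on [0, d] of the exponentials whose frequencies differ by a
    nonzero multiple of 2 pi / d. *)
Lemma hat_one_lattice (n : nat) (b : bool) : n != 0%N ->
  hat 1 ((-1) ^+ b * (2 * pi / d * n%:R)) = 0.
Proof.
move=> n0; set x := _ * _.
have d0' : d != 0 by rewrite gt_eqF.
have x0 : x != 0.
  by rewrite /x !mulf_neq0 ?invr_eq0 ?pnatr_eq0// ?signr_eq0// gt_eqF// pi_gt0.
have xd : x * d = (-1) ^+ b * (2 * pi * n%:R).
  by rewrite /x; field.
have sd : sin (x * d) = 0.
  by rewrite xd; case: b {x x0 xd}; rewrite ?expr1 ?mulN1r ?expr0 ?mul1r ?sinN sin_2pin ?oppr0.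
have cd : cos (x * d) = 1.
  by rewrite xd; case: b {x x0 xd sd}; rewrite ?expr1 ?mulN1r ?expr0 ?mul1r ?cosN cos_2pin.
apply: complex_eq => /=.
- transitivity (x^-1 * sin (x * d) - x^-1 * sin (x * 0)); last first.
    by rewrite sd [x * 0]mulr0 sin0 subrr.
  apply: (@cint_FTC2 _ 0 d _ (fun s => x^-1 * sin (x * s))) => //.
  + exact: continuous_pcos.
  + move=> s; have h2 := is_derive_sinM x s.
    by apply: is_derive_eq; rewrite /GRing.scale/= horner1; field.
- transitivity (- x^-1 * cos (x * d) - - x^-1 * cos (x * 0)); last first.
    by rewrite cd [x * 0]mulr0 cos0 subrr.
  apply: (@cint_FTC2 _ 0 d _ (fun s => - x^-1 * cos (x * s))) => //.
  + exact: continuous_psin.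
  + move=> s; have h2 := is_derive_cosM x s.
    by apply: is_derive_eq; rewrite /GRing.scale/= horner1; field.
Qed.

End Transform.

(** * Trigonometric polynomials with values in a Hilbert space *)

Section Hilbert.
Context {R : realType} (K : completeNormedModType R[i]) (dotK : {dot K for Num.conj}).
Hypothesis hK : hilbert_norm dotK.
Implicit Types (x y : K) (z : R[i]) (c : R).

Definition sqnorm x : R := rnorm x ^+ 2.

Lemma dotC x y : dotK x y = Num.conj (dotK y x).
Proof. by rewrite hermC expr0 mul1r. Qed.

Lemma sqnormE x : sqnorm x = Re (dotK x x).
Proof.
rewrite -hK /sqnorm /rnorm.
have : `|x| \is Num.real by rewrite normr_real.
by move=> /RRe_real {2}<-; rewrite -rmorphXn.
Qed.

Lemma dotxx x : dotK x x = (sqnorm x)%:C.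
Proof.
rewrite -hK /sqnorm /rnorm.
have : `|x| \is Num.real by rewrite normr_real.
by move=> /RRe_real {1}<-; rewrite -rmorphXn.
Qed.

Lemma sqnorm_ge0 x : 0 <= sqnorm x. Proof. exact: sqr_ge0. Qed.

Lemma dotZl z x y : dotK (z *: x) y = z * dotK x y.
Proof. exact: linearZl_LR. Qed.

Lemma dotZr z x y : dotK x (z *: y) = Num.conj z * dotK x y.
Proof. exact: linearZr_LR. Qed.

Lemma dotDl u x y : dotK (x + y) u = dotK x u + dotK y u.
Proof. exact: linearDl. Qed.

Lemma dotDr u x y : dotK u (x + y) = dotK u x + dotK u y.
Proof. exact: linearDr. Qed.

Lemma sqnormZ z x : sqnorm (z *: x) = csq z * sqnorm x.
Proof.
rewrite !sqnormE dotZl dotZr mulrA mulC_conj. by rewrite cReM /= mul0r subr0.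
Qed.

Lemma sqnorm0_eq0 x : sqnorm x = 0 -> x = 0.
Proof.
move=> h; apply/eqP; rewrite -normr_eq0 -sqrf_eq0 hK dotxx h.
by [].
Qed.

Lemma sqnormBr c x y :
  sqnorm (x - c%:C *: y) = sqnorm x - 2 * c * Re (dotK x y) + c ^+ 2 * sqnorm y.
Proof.
rewrite -scaleNr !sqnormE dotDl !dotDr !dotZl !dotZr (dotC y x).
by rewrite !(cReD, cReM, cImM, cRe_conj, cIm_conj) /=; ring.
Qed.

Lemma sqnormD x y : sqnorm (x + y) <= 2 * sqnorm x + 2 * sqnorm y.
Proof.
have := sqnorm_ge0 (x - 1%:C *: y); rewrite sqnormBr.
have -> : sqnorm (x + y) = sqnorm x + sqnorm y + 2 * Re (dotK x y).
  rewrite !sqnormE dotDl !dotDr (dotC y x) !cReD cRe_conj; ring.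
lra.
Qed.

Lemma Re_dot_sum (I J : Type) (r : seq I) (s : seq J) (u : I -> K) (v : J -> K) :
  Re (dotK (\sum_(i <- r) u i) (\sum_(j <- s) v j)) =
  \sum_(i <- r) \sum_(j <- s) Re (dotK (u i) (v j)).
Proof.
rewrite linear_sumlz /= raddf_sum /=; apply: eq_bigr => i _.
by rewrite linear_sumr raddf_sum.
Qed.

Section TrigPoly.
Variables (X : Type) (w : X -> R) (g : X -> K).
Implicit Types (r : seq X) (a : X -> R[i]).

Definition trig r a (t : R) : K := \sum_(i <- r) (expi (w i * t) * a i) *: g i.

Lemma sqnorm_trig r a t : sqnorm (trig r a t) = \sum_(i <- r) \sum_(j <- r)
  Re ((1 : {poly R}).[t]%:C * expi ((w i - w j) * t) *
      (a i * Num.conj (a j) * dotK (g i) (g j))).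
Proof.
rewrite sqnormE Re_dot_sum; apply: eq_bigr => i _; apply: eq_bigr => j _.
rewrite dotZl dotZr hornerC mul1r mulrBl expiD expiN; congr Re.
by rewrite !rmorphM; ring.
Qed.

Lemma continuous_sqnorm_trig r a : continuous (fun t => sqnorm (trig r a t)).
Proof.
rewrite (funext (sqnorm_trig r a)).
apply: continuous_sumf => i; apply: continuous_sumf => j.
exact: continuous_Re_expi.
Qed.

Lemma trig_shift r a t s : trig r a (t + s) = trig r (fun i => expi (w i * t) * a i) s.
Proof.
by apply: eq_bigr => i _; rewrite mulrDr expiD; congr (_ *: _); ring.
Qed.

(** Bessel's inequality on [0, d] for the frequencies xi, whose exponentials are
    orthogonal there.  It comes from expanding the square of the distance from
    p f to (1/d) sum_y e^(i xi_y s) F_y, where the F_y are the Fourier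
    coefficients of p f. *)
Lemma bessel (d : R) (p : {poly R}) (Y : finType) (xi : Y -> R) r a : 0 < d ->
  (forall s, 0 <= s <= d -> 0 <= p.[s] <= 1) ->
  (forall y y' : Y, y != y' -> hat d 1 (xi y - xi y') = 0) ->
  \sum_y sqnorm (\sum_(i <- r) (hat d p (w i - xi y) * a i) *: g i) <=
    d * cint 0 d (fun s => sqnorm (trig r a s)).
Proof.
move=> d0 p01 orth.
pose F (y : Y) := \sum_(i <- r) (hat d p (w i - xi y) * a i) *: g i.
rewrite -/(F _) [leLHS](_ : _ = \sum_y sqnorm (F y))//.
set S := \sum_y _.
pose G s := \sum_y expi (xi y * s) *: F y.
have Gc s : sqnorm (G s) = \sum_y \sum_y'
    Re ((1 : {poly R}).[s]%:C * expi ((xi y - xi y') * s) * dotK (F y) (F y')).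
  rewrite sqnormE Re_dot_sum; apply: eq_bigr => y _; apply: eq_bigr => y' _.
  rewrite dotZl dotZr hornerC mul1r mulrBl expiD expiN; congr Re; ring.
have fG s : Re (dotK (p.[s]%:C *: trig r a s) (G s)) = \sum_y \sum_(i <- r)
    Re (p.[s]%:C * expi ((w i - xi y) * s) * (a i * dotK (g i) (F y))).
  rewrite /trig scaler_sumr Re_dot_sum exchange_big; apply: eq_bigr => y _.
  apply: eq_bigr => i _; rewrite !dotZl dotZr mulrBl expiD expiN; congr Re; ring.
have Gcont : continuous (fun s => sqnorm (G s)).
  rewrite (funext Gc); apply: continuous_sumf => y; apply: continuous_sumf => y'.
  exact: continuous_Re_expi.
have fGcont : continuous (fun s => Re (dotK (p.[s]%:C *: trig r a s) (G s))).
  rewrite (funext fG); apply: continuous_sumf => y; apply: continuous_sumf => i.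
  exact: continuous_Re_expi.
have Gint : cint 0 d (fun s => sqnorm (G s)) = d * S.
  rewrite (funext Gc) cint_sum; last first.
    by move=> y; apply: continuous_sumf => y'; exact: continuous_Re_expi.
  rewrite mulr_sumr; apply: eq_bigr => y _.
  rewrite cint_sum; last by move=> y'; exact: continuous_Re_expi.
  rewrite (bigD1 y)//= cint_Re_expi// subrr hat_one0// big1 ?addr0.
    by rewrite dotxx cReM /= mul0r subr0.
  by move=> y' yy'; rewrite cint_Re_expi// orth 1?eq_sym// mul0r.
have fGint : cint 0 d (fun s => Re (dotK (p.[s]%:C *: trig r a s) (G s))) = S.
  rewrite (funext fG) cint_sum; last first.
    by move=> y; apply: continuous_sumf => i; exact: continuous_Re_expi.
  apply: eq_bigr => y _; rewrite cint_sum; last by move=> i; exact: continuous_Re_expi.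
  rewrite sqnormE {2}/F linear_sumlz /= raddf_sum/=; apply: eq_bigr => i _.
  by rewrite cint_Re_expi// dotZl mulrA.
have pf s : sqnorm (p.[s]%:C *: trig r a s) = p.[s] ^+ 2 * sqnorm (trig r a s).
  by rewrite sqnormZ csq_real.
have tcont := @continuous_sqnorm_trig r a.
pose h s := sqnorm (trig r a s) + (- (2 * d^-1) * Re (dotK (p.[s]%:C *: trig r a s) (G s))
   + d^-1 ^+ 2 * sqnorm (G s)).
have : 0 <= cint 0 d h.
  apply: cint_ge0 => s /p01/andP[ps0 ps1].
  apply: (@le_trans _ _ (sqnorm (p.[s]%:C *: trig r a s - d^-1%:C *: G s))).
    exact: sqnorm_ge0.
  rewrite sqnormBr pf /h mulNr addrA lerD2r lerD2r ler_piMl ?sqnorm_ge0//.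
  by rewrite exprn_ile1.
rewrite /h cintD; [|exact: tcont|]; last first.
  by apply: continuous_addf; apply: continuous_scale.
rewrite cintD; [|exact: continuous_scale|exact: continuous_scale].
rewrite !cintZ// fGint Gint => H.
rewrite -ler_pdivrMl//.
have -> : d^-1 * S = 2 * d^-1 * S - d^-1 ^+ 2 * (d * S) by field; rewrite gt_eqF.
by move: H; lra.
Qed.

(** [bessel] at a shifted time; on the right the short interval [t, t + d] is
    enlarged to [0, tau + d], uniformly in t. *)
Lemma window_bessel (d tau t : R) (p : {poly R}) (Y : finType) (xi : Y -> R) r a :
  0 < d -> 0 <= t <= tau ->
  (forall s, 0 <= s <= d -> 0 <= p.[s] <= 1) ->
  (forall y y' : Y, y != y' -> hat d 1 (xi y - xi y') = 0) ->
  \sum_y sqnorm (trig r (fun i => hat d p (w i - xi y) * a i) t) <=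
    d * cint 0 (tau + d) (fun s => sqnorm (trig r a s)).
Proof.
move=> d0 /andP[t0 tT] p01 orth.
have := bessel r (fun i => expi (w i * t) * a i) d0 p01 orth.
have -> : (fun s => sqnorm (trig r (fun i => expi (w i * t) * a i) s)) =
    (fun s => sqnorm (trig r a (t + s))).
  by apply/funext => s; rewrite trig_shift.
under eq_bigr do under eq_bigr do rewrite mulrCA.
move=> /le_trans; apply; rewrite ler_pM2l//.
apply: cint_shift_le => //.
- exact: continuous_sqnorm_trig.
- by move=> s; exact: sqnorm_ge0.
- by rewrite lerD2r.
Qed.

End TrigPoly.

End Hilbert.

(** * Lower bound for free families *)

Section Gram.
Context {R : realType} (K : completeNormedModType R[i]) (dotK : {dot K for Num.conj}).
Hypothesis hK : hilbert_norm dotK.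

(** Cauchy-Schwarz, from the square norm of x minus its projection on y. *)
Lemma csq_dot_le (x y : K) : csq (dotK x y) <= sqnorm x * sqnorm y.
Proof.
have [->|y0] := eqVneq y 0.
  by rewrite linear0r /csq /= expr0n addr0 mulr_ge0 ?sqnorm_ge0.
have ny : 0 < sqnorm y.
  rewrite lt_neqAle sqnorm_ge0 andbT eq_sym.
  by apply: contra_neq y0; exact: (sqnorm0_eq0 hK).
have := sqnorm_ge0 (x - 1%:C *: (((sqnorm y)^-1%:C * dotK x y) *: y)).
rewrite (sqnormBr hK) (sqnormZ hK) (dotZr dotK) csqM csq_real.
set z := dotK x y.
have -> : Re (Num.conj ((sqnorm y)^-1%:C * z) * z) = (sqnorm y)^-1 * csq z.
  by rewrite /csq !(cReM, cIm_conj, cRe_conj, cImM) /=; ring.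
rewrite mulr1 expr1n mul1r exprVn -ler_pdivrMr//.
have -> : (sqnorm y ^+ 2)^-1 * csq z * sqnorm y = (sqnorm y)^-1 * csq z.
  by field; rewrite gt_eqF.
rewrite [csq z / _]mulrC; lra.
Qed.

Lemma dot_suml (I : Type) (r : seq I) (F : I -> K) y :
  dotK (\sum_(i <- r) F i) y = \sum_(i <- r) dotK (F i) y.
Proof. exact: linear_sumlz. Qed.

Lemma dot_sumr (I : Type) (r : seq I) (F : I -> K) x :
  dotK x (\sum_(i <- r) F i) = \sum_(i <- r) dotK x (F i).
Proof. exact: linear_sumr. Qed.

Lemma csq_sum_le (I : Type) (r : seq I) (F : I -> R[i]) :
  csq (\sum_(i <- r) F i) <= 2 ^+ size r * \sum_(i <- r) csq (F i).
Proof.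
elim: r => [|i r ih]; first by rewrite !big_nil /csq/= expr0n addr0 mulr0.
rewrite !big_cons /= exprS; apply: le_trans (csqD _ _) _.
have h1 := csq_ge0 (F i); have h2 : 1 <= 2 ^+ size r :> R by rewrite exprn_ege1// ler1n.
have h3 : csq (F i) <= 2 ^+ size r * csq (F i) by rewrite ler_peMl.
lra.
Qed.

(** Multiplying by the inverse of the Gram matrix recovers the coefficients of a
    vector from its scalar products with the family. *)
Lemma free_lower_bound (n : nat) (v : 'I_n -> K) :
  (forall c : 'I_n -> R[i], \sum_i c i *: v i = 0 -> forall i, c i = 0) ->
  exists2 kap, 0 < kap & forall c : 'I_n -> R[i],
    kap * \sum_i csq (c i) <= sqnorm (\sum_i c i *: v i).
Proof.
move=> free; pose G : 'M[R[i]]_n := \matrix_(i, j) dotK (v i) (v j).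
have GE (c : 'rV[R[i]]_n) j : (c *m G) 0 j = dotK (\sum_i c 0 i *: v i) (v j).
  rewrite mxE dot_suml; apply: eq_bigr => i _.
  by rewrite mxE (dotZl dotK).
have Gfree : row_free G.
  apply: inj_row_free => c cG; apply/rowP => i; rewrite [RHS]mxE.
  apply: (free (fun i => c 0 i)); apply: (sqnorm0_eq0 hK).
  rewrite (sqnormE hK) dot_sumr big1//= => j _.
  by have := GE c j; rewrite cG mxE (dotZr dotK) => <-; rewrite mulr0.
have Gu : G \in unitmx by rewrite -row_free_unit.
pose H := invmx G.
pose M := 1 + \sum_(i < n) 2 ^+ size (index_enum 'I_n) *
  \sum_(j < n) (sqnorm (v j) * csq (H j i)).
have M0 : 0 < M.
  rewrite ltr_pwDl// sumr_ge0// => i _; rewrite mulr_ge0 ?exprn_ge0// sumr_ge0// => j _.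
  by rewrite mulr_ge0 ?sqnorm_ge0 ?csq_ge0.
exists M^-1; first by rewrite invr_gt0.
move=> c; set S := \sum_i c i *: v i.
rewrite ler_pdivrMl//.
pose cv : 'rV[R[i]]_n := \row_i c i.
have cvS : \sum_i cv 0 i *: v i = S by apply: eq_bigr => i _; rewrite mxE.
have cE i : c i = \sum_j dotK S (v j) * H j i.
  have -> : c i = (cv *m G *m H) 0 i by rewrite mulmxK// mxE.
  by rewrite mxE; apply: eq_bigr => j _; rewrite GE cvS.
apply: (@le_trans _ _ (\sum_(i < n) (2 ^+ size (index_enum 'I_n) *
    \sum_(j < n) (sqnorm (v j) * csq (H j i))) * sqnorm S)).
  apply: ler_sum => i _; rewrite {1}cE; apply: le_trans (csq_sum_le _ _) _.
  rewrite -mulrA ler_pM2l ?exprn_gt0// mulr_suml; apply: ler_sum => j _.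
  by rewrite csqM mulrAC ler_wpM2r ?csq_ge0// mulrC csq_dot_le.
rewrite -mulr_suml ler_wpM2r ?sqnorm_ge0//.
by rewrite /M lerDr.
Qed.

End Gram.

(** * Dyadic blocks and sums of real numbers *)

Section RealLemmas.
Context {R : realType}.
Implicit Types x y : R.

(** A frequency x outside the block of a window centre zeta, or on the other side
    of 0, is far from zeta in the relative sense.  Blocks overlap, as alpha * rho
    < 1, which is what leaves room around every centre. *)
Lemma block_gap (alpha rho q zeta x : R) :
  0 < alpha < 1 -> 1 < rho < alpha^-1 -> q <= zeta < q * rho ->
  ~~ (alpha * q <= x < q / alpha) ->
  (1 - alpha * rho) / 2 * (`|x| + zeta) <= `|x - zeta|.
Proof.
move=> /andP[a0 a1] /andP[r1 ra] /andP[qz zq].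
have ar : alpha * rho < 1 by rewrite -lter_pdivlMl// mulr1.
have q0 : 0 < q.
  by rewrite -(@pmulr_rgt0 _ (rho - 1)) ?subr_gt0// mulrBl mul1r mulrC subr_gt0 (le_lt_trans qz).
have ar0 : 0 < alpha * rho by rewrite mulr_gt0//; lra.
have aar : alpha <= alpha * rho by nra.
set k := alpha * rho in ar ar0 aar *.
have z0 : 0 < zeta by exact: lt_le_trans qz.
have aqz : alpha * q <= alpha * zeta by rewrite ler_pM2l.
have akz : alpha * zeta <= k * zeta by rewrite ler_pM2r.
have kz : k * zeta < zeta by rewrite -[ltRHS]mul1r ltr_pM2r.
have kzp : 0 < k * zeta by rewrite mulr_gt0.
rewrite negb_and -ltNge -leNgt => /orP[xq|xq].
- rewrite [leRHS]ler0_norm; last by lra.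
  have [x0|x0] := ger0P x; last first.
    have : k * x < 0 by rewrite pmulr_rlt0.
    lra.
  have : x <= k * zeta by lra.
  have : 0 <= (1 - k) * (zeta - x) by rewrite mulr_ge0 ?subr_ge0//; lra.
  lra.
- have zx : zeta <= k * x.
    apply: (@le_trans _ _ (q * rho)); first exact: ltW.
    move: xq; rewrite ler_pdivrMr// => xq.
    have : rho * q <= rho * (x * alpha) by rewrite ler_pM2l//; lra.
    rewrite /k; lra.
  have x0 : 0 < x by rewrite -(@pmulr_rgt0 _ k)//; lra.
  have kx : k * x < x by rewrite -[ltRHS]mul1r ltr_pM2r.
  rewrite (gtr0_norm x0) ger0_norm; last by lra.
  have : 0 <= (1 - k) * (x - zeta) by rewrite mulr_ge0 ?subr_ge0//; lra.
  lra.
Qed.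

Lemma bernoulli_le (rho : R) n : 1 <= rho -> 1 + n%:R * (rho - 1) <= rho ^+ n.
Proof.
move=> r1; elim: n => [|n ih]; first by rewrite mul0r addr0 expr0.
rewrite exprS -natr1.
have h1 : 0 <= n%:R * (rho - 1) ^+ 2 by rewrite mulr_ge0 ?sqr_ge0.
have h2 : rho * (1 + n%:R * (rho - 1)) <= rho * rho ^+ n by rewrite ler_wpM2l//; lra.
lra.
Qed.

Lemma geometric_bracket (rho : R) k0 y : 1 < rho -> rho ^+ k0 <= y ->
  exists k, (k0 <= k)%N /\ rho ^+ k <= y < rho ^+ k * rho.
Proof.
move=> r1 y0.
have ex : exists m, y < rho ^+ m.
  exists (Num.truncn (y / (rho - 1))).+1.
  apply: lt_le_trans (bernoulli_le _ (ltW r1)).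
  have : y / (rho - 1) < (Num.truncn (y / (rho - 1))).+1%:R.
    exact: truncnS_gt.
  rewrite ltr_pdivrMr; last lra.
  lra.
case: (ex_minnP ex) => m hm mmin.
have km : (k0 < m)%N.
  rewrite ltnNge; apply/negP => mk.
  have : rho ^+ m <= rho ^+ k0 by rewrite ler_weXn2l// ltW.
  by move=> /le_trans/(_ y0); rewrite leNgt hm.
case: m km hm mmin => // m km hm mmin.
exists m; split => //; rewrite -exprSr hm andbT leNgt.
by apply/negP => /mmin; rewrite ltnn.
Qed.

(** 1/(n+1)^2 is at most 2/(n+1) - 2/(n+2). *)
Lemma sum_invsq_le (Q : nat) : \sum_(n < Q) ((n.+1%:R ^+ 2)^-1 : R) <= 2.
Proof.
suff : \sum_(n < Q) ((n.+1%:R ^+ 2)^-1 : R) <= 2 - 2 / Q.+1%:R.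
  by move=> /le_trans; apply; rewrite gerBl.
elim: Q => [|Q ih]; first by rewrite big_ord0 divr1 subrr.
rewrite big_ord_recr /=; apply: le_trans (lerD ih (lexx _)) _.
have q0 : 0 < Q.+1%:R :> R by rewrite ltr0n.
have q1 : 1 <= Q.+1%:R :> R by rewrite ler1n.
rewrite -[Q.+2%:R]natr1; set q : R := Q.+1%:R in q0 q1 *.
rewrite -addrA lerD2l -subr_ge0.
have -> : - (2 / (q + 1)) - (- (2 / q) + (q ^+ 2)^-1) = (q - 1) / (q ^+ 2 * (q + 1)).
  by field; rewrite !gt_eqF//; lra.
by rewrite divr_ge0// ?mulr_ge0//; nra.
Qed.

Lemma sum_ge_term (I : finType) (P : pred I) (F : I -> R) (i : I) :
  (forall j, P j -> 0 <= F j) -> P i -> F i <= \sum_(j | P j) F j.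
Proof.
move=> F0 Pi; rewrite (bigD1 i)//= lerDl sumr_ge0// => j /andP[Pj _]; exact: F0.
Qed.

End RealLemmas.

(** * Observability of trigonometric polynomials *)

Section Observability.
Context {R : realType} (K : completeNormedModType R[i]) (dotK : {dot K for Num.conj}).
Hypothesis hK : hilbert_norm dotK.
(* w, g: frequency and observation of a mode; a: its weight in the energy that is
   to be bounded; b: its weight in the a priori bound of the observation, which
   may exceed a by a power of the frequency. *)
Variables (X : eqType) (w : X -> R) (g : X -> K) (a b : X -> R).
Variables (alpha rho : R) (k0 : nat) (C T B : R) (m : nat).
Hypothesis halpha : 0 < alpha < 1.
Hypothesis hrho : 1 < rho < alpha^-1.
Hypothesis hC : 0 < C.
Hypothesis hT : 0 < T.
Hypothesis hB : 0 <= B.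
Hypothesis a_gt0 : forall i, 0 < a i.
Hypothesis b_ge0 : forall i, 0 <= b i.
Hypothesis b_le : forall i, b i <= a i * (B * (1 + `|w i|) ^+ m).
Hypothesis upper : forall r (c : X -> R[i]), uniq r ->
  sqnorm (\sum_(i <- r) c i *: g i) <= \sum_(i <- r) b i * csq (c i).
Hypothesis block_obs : forall (k : nat) (s : bool) r (c : X -> R[i]),
  (k0 <= k)%N -> uniq r ->
  (forall i, i \in r -> alpha * rho ^+ k <= (-1) ^+ s * w i < rho ^+ k / alpha) ->
  \sum_(i <- r) a i * csq (c i) <= C * cint 0 T (fun t => sqnorm (trig w g r c t)).
Hypothesis discrete : forall W : R, exists s : seq X, uniq s /\
  forall i, `|w i| <= W -> i \in s.
Hypothesis no_eigen : forall r (c : X -> R[i]) mu, uniq r ->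
  (forall i, i \in r -> w i = mu) -> \sum_(i <- r) c i *: g i = 0 ->
  forall i, i \in r -> c i = 0.

Local Notation f r c := (fun t => sqnorm (trig w g r c t)).

(** One constant serves all finite sums: this uniformity is what survives the
    passage from truncated waves to waves. *)
Definition observable (P : pred X) (tau : R) := exists2 C', 0 < C' &
  forall r (c : X -> R[i]), uniq r -> all P r ->
  \sum_(i <- r) a i * csq (c i) <= C' * cint 0 tau (f r c).

Let cf r c : continuous (f r c).
Proof. exact: continuous_sqnorm_trig. Qed.

Let f_ge0 r c t : 0 <= sqnorm (trig w g r c t).
Proof. exact: sqnorm_ge0. Qed.

Let trig_upper r c t : uniq r ->
  sqnorm (trig w g r c t) <= \sum_(i <- r) b i * csq (c i).
Proof.
move=> ur; apply: le_trans (upper _ ur) _.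
by under eq_bigr do rewrite csqM csq_expi mul1r.
Qed.

Let trig_split r c t (P : pred X) :
  trig w g r c t = trig w g [seq i <- r | P i] c t + trig w g [seq i <- r | ~~ P i] c t.
Proof. by rewrite /trig !big_filter (bigID P). Qed.

(** Block observability for a sum that is only concentrated in one block: the
    modes outside the block enter through the a priori bound. *)
Let one_window r (c : X -> R[i]) k (s : bool) :
  let P i := alpha * rho ^+ k <= (-1) ^+ s * w i < rho ^+ k / alpha in
  (k0 <= k)%N -> uniq r ->
  \sum_(i <- r | P i) a i * csq (c i) <= 2 * C * cint 0 T (f r c) +
    2 * C * T * \sum_(i <- r | ~~ P i) b i * csq (c i).
Proof.
move=> P kk ur.
rewrite -big_filter.
have h : forall i, i \in [seq i <- r | P i] -> P i by move=> i; rewrite mem_filter => /andP[].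
apply: le_trans (block_obs c kk (filter_uniq _ ur) h) _.
set D := \sum_(i <- r | _) _.
have -> : 2 * C * cint 0 T (f r c) + 2 * C * T * D =
   C * (2 * cint 0 T (f r c) + 2 * D * (T - 0)) by rewrite subr0; ring.
rewrite ler_pM2l// -cintZ// -cint_cst; last exact: ltW.
rewrite -cintD//; last 2 first.
- exact: continuous_scale.
- exact: cst_continuous.
apply: le_cint => //.
  apply: continuous_addf; [exact: continuous_scale|exact: cst_continuous].
move=> t _.
have -> : trig w g [seq i <- r | P i] c t =
    trig w g r c t + (-1) *: trig w g [seq i <- r | ~~ P i] c t.
  by rewrite (trig_split r c t P) scaleN1r addrK.
apply: le_trans (sqnormD hK _ _) _; rewrite lerD2l ler_pM2l// (sqnormZ hK).
rewrite csqN1 mul1r; apply: le_trans (trig_upper _ _ (filter_uniq _ ur)) _.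
by rewrite big_filter.
Qed.

(** The window centres are xi s j n = (-1)^s zeta j n, with zeta j n = Xi + h (j + 8 n):
    for each sign s and each j < 8 they form a translate of a half-line of
    (2 pi / d) Z, as needed for Bessel's inequality, and the 16 families together
    have mesh h with h d <= 1, so that every frequency beyond Xi is at a distance
    from some centre at which [hat] is bounded below. *)
Lemma high_frequency (d : R) : 0 < d <= 1 ->
  exists W, observable (fun i => W <= `|w i|) (T + d).
Proof.
move=> /andP[d0 d1].
have [a0 a1] := andP halpha; have [r1 ra] := andP hrho.
(* m powers of decay pay for b / a, two for the sum over the centres, and the
   others make the remainders small at high frequency. *)
pose N := m.+2; pose p := window d N.
have NE : (N * 2 = 2 + (m * 2).+2)%N by rewrite /N !mulSn.
have p01 s : 0 <= s <= d -> 0 <= p.[s] <= 1.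
  by move=> sd; rewrite window_ge0 ?window_le1.
have [CN CN0 decay] := hat_window_decay d0 N.
pose c0 := (cos 1 * hatc d p 0) ^+ 2.
have c0_gt0 : 0 < c0.
  by rewrite /c0 exprn_gt0// mulr_gt0 ?cos1_gt0// hat_window0_gt0.
have h0 : 0 < pi / (4 * d) :> R by rewrite divr_gt0 ?pi_gt0// mulr_gt0.
set h : R := pi / (4 * d) in h0.
have pi4 : pi < 4 :> R by have := pihalf_lt2 R; lra.
have hd : h * d <= 1.
  have -> : h * d = pi / 4 by rewrite /h; field; rewrite gt_eqF.
  by rewrite ler_pdivrMr// mul1r ltW.
pose Xi := rho ^+ k0.
have Xi1 : 1 <= Xi by rewrite exprn_ege1// ltW.
pose zeta (j : 'I_8) (n : nat) := Xi + h * (j + 8 * n)%:R.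
have zetaXi j n : Xi <= zeta j n by rewrite lerDl mulr_ge0// ltW.
have h8 : 1 <= h * 8.
  have -> : h * 8 = 2 * pi / d by rewrite /h; field; rewrite gt_eqF.
  by rewrite ler_pdivlMr// mul1r; have := pi_ge2 R; lra.
have zeta_n j (n : nat) : n.+1%:R <= zeta j n.
  rewrite /zeta -natr1 natrD natrM.
  have h1 : 0 <= h * j%:R by rewrite mulr_ge0// ltW.
  have h2 : n%:R <= h * 8 * n%:R by rewrite ler_peMl.
  lra.
(* kk y is the index of the block that serves a window centred at +/- y. *)
have /choice[kk hkk] : forall y : R, exists k : nat, rho ^+ k0 <= y ->
    (k0 <= k)%N /\ rho ^+ k <= y < rho ^+ k * rho.
  move=> y; have [y0|y0] := leP (rho ^+ k0) y.
    by have [k hk] := geometric_bracket r1 y0; exists k.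
  by exists 0%N.
pose blk (s : bool) j n i :=
  alpha * rho ^+ kk (zeta j n) <= (-1) ^+ s * w i < rho ^+ kk (zeta j n) / alpha.
pose xi (s : bool) j n := (-1) ^+ s * zeta j n.
pose kap := (1 - alpha * rho) / 2.
have ar : alpha * rho < 1 by rewrite -lter_pdivlMl// mulr1.
have kap0 : 0 < kap by rewrite divr_gt0// subr_gt0.
have gap s j n i : ~~ blk s j n i -> kap * (`|w i| + zeta j n) <= `|w i - xi s j n|.
  move=> nb; have [_ hq] := hkk _ (zetaXi j n).
  have := block_gap halpha hrho hq nb.
  have -> : `|(-1) ^+ s * w i| = `|w i| by rewrite normrM normrX normrN1 expr1n mul1r.
  have -> : (-1) ^+ s * w i - zeta j n = (-1) ^+ s * (w i - xi s j n).
    by rewrite mulrBr mulrA -signr_addb addbb mul1r.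
  by rewrite normrM normrX normrN1 expr1n mul1r.
clearbody kap.
(* K1 / |w| bounds the total of the remainders of a mode, relative to a; 32 is 16
   families times the sum of the 1/(n+1)^2.  In the threshold W, the second term
   puts the nearest centre and the mode in the same block, and the last one makes
   the remainders absorbable. *)
pose K1 := B * 2 ^+ m * CN / kap ^+ (N * 2) * 32.
have K10 : 0 <= K1.
  by rewrite /K1 !mulr_ge0 ?invr_ge0 ?exprn_ge0//; exact: ltW.
pose W := Xi + (kap * d)^-1 + 1 + 4 * C * T * K1 / c0.
have kd0 : 0 < kap * d by rewrite mulr_gt0.
have W0 : 0 <= 4 * C * T * K1 / c0.
  apply: divr_ge0; last exact: ltW.
  by apply: mulr_ge0 => //; apply: mulr_ge0; [apply: mulr_ge0 => //|]; exact: ltW.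
have W0' : 0 < (kap * d)^-1 by rewrite invr_gt0.
have W1 : 1 <= W by rewrite /W; lra.
have WXi : Xi <= W by rewrite /W; lra.
have WK : 4 * C * T * K1 / c0 <= W by rewrite /W; lra.
have Wk : 1 < kap * d * W.
  by rewrite -ltr_pdivrMl// mulr1 /W; lra.
exists W, (64 * C * T * d / c0); first by rewrite divr_gt0// !mulr_gt0.
move=> r c ur rW.
have {}rW i : i \in r -> W <= `|w i| by move/(allP rW).
pose Q := (\max_(i <- r) (Num.truncn ((`|w i| - Xi) / h))).+1.
pose ht s j n i := hat d p (w i - xi s j n).
pose I := cint 0 (T + d) (f r c).
have win s j n := one_window (fun i => ht s j n i * c i) s (hkk _ (zetaXi j n)).1 ur.
have bes s j : \sum_(n < Q) cint 0 T (f r (fun i => ht s j n i * c i)) <= T * (d * I).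
  rewrite -cint_sum; last by move=> n; exact: cf.
  rewrite [leRHS]mulrC -[X in _ * X]subr0 -cint_cst; last exact: ltW.
  apply: le_cint; [by apply: continuous_sumf => n; exact: cf|exact: cst_continuous|].
  move=> t tT.
  apply: (@window_bessel _ _ _ hK _ w g d T t p 'I_Q (fun n => xi s j n) r c d0 tT p01).
  move=> n n' nn'.
  (* exchanging the centres amounts to changing the sign s *)
  wlog lt_nn' : n n' s nn' / (n' < n)%N.
    move=> hw; case: (ltngtP n' n) => h'.
    - exact: hw.
    - have := hw n' n (~~ s); rewrite eq_sym nn' => /(_ isT h') <-.
      congr (hat _ _ _); rewrite /xi -[~~ s]addbT signr_addb expr1; ring.
    - by move: nn'; rewrite -val_eqE /= h' eqxx.
  have -> : xi s j n - xi s j n' = (-1) ^+ s * (2 * pi / d * (n - n')%N%:R).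
    rewrite /xi -mulrBr; congr (_ * _); rewrite /zeta natrB; last exact: ltnW.
    have nE (l : nat) : (j + 8 * l)%:R = j%:R + 8 * l%:R :> R by rewrite natrD natrM.
    rewrite !nE /h; field; by rewrite gt_eqF.
  by rewrite hat_one_lattice// -lt0n subn_gt0.
have cover i : i \in r -> exists s j, exists n : 'I_Q, blk s j n i /\ c0 <= csq (ht s j n i).
  move=> ir; have xW := rW _ ir.
  pose q := Num.truncn ((`|w i| - Xi) / h).
  have q0 : 0 <= (`|w i| - Xi) / h.
    by rewrite divr_ge0 ?(ltW h0)// subr_ge0 (le_trans WXi).
  have /andP[q1 q2] := truncn_itv q0; rewrite -/q in q1 q2.
  have qQ : (q %/ 8 < Q)%N.
    rewrite ltnS; apply: leq_trans (leq_div _ _) _.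
    by rewrite (bigD1_seq i)//= leq_maxl.
  pose s := w i < 0.
  exists s, (inord (q %% 8)), (Ordinal qQ).
  have wE : w i = (-1) ^+ s * `|w i|.
    by rewrite /s; case: ltP => hw; rewrite ?expr1 ?expr0 ?(ltr0_norm hw) ?(ger0_norm hw); ring.
  have zE : zeta (inord (q %% 8)) (Ordinal qQ) = Xi + h * q%:R.
    rewrite /zeta inordK ?ltn_mod//=; congr (_ + h * _%:R).
    by rewrite addnC mulnC -divn_eq.
  have dist : `|w i - xi s (inord (q %% 8)) (Ordinal qQ)| <= h.
    rewrite {1}wE /xi -mulrBr normrM normrX normrN1 expr1n mul1r zE.
    move: q1 q2; rewrite ler_pdivlMr// ltr_pdivrMr// -natr1 => q1 q2.
    rewrite ger0_norm; lra.
  split; last first.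
    apply: hat_window_lower => //; apply: le_trans hd.
    by rewrite ler_pM2r.
  apply: contraT => /gap/le_trans/(_ dist) H.
  have : kap * d * W <= 1.
    apply: le_trans hd; rewrite mulrAC ler_pM2r//; apply: le_trans H.
    rewrite ler_pM2l//; apply: le_trans xW _; rewrite lerDl zE.
    apply: addr_ge0; first exact: le_trans Xi1.
    by apply: mulr_ge0 => //; exact: ltW.
  by rewrite leNgt Wk.
have err i : i \in r ->
  b i * (\sum_(s : bool) \sum_(j < 8) \sum_(n < Q | ~~ blk s j n i) csq (ht s j n i)) <=
  a i * (c0 / (4 * C * T)).
  move=> ir; have xW := rW _ ir; set x := `|w i| in xW.
  have x1 : 1 <= x := le_trans W1 xW.
  have x0 : 0 < x := lt_le_trans ltr01 x1.
  have [M ME] : exists M, M = CN / kap ^+ (N * 2) / x ^+ (m * 2).+2 by eexists.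
  have M0 : 0 <= M.
    by rewrite ME !divr_ge0 ?exprn_ge0// ?(ltW kap0)// (ltW x0).
  have each s j n : ~~ blk s j n i -> csq (ht s j n i) <= M * (n.+1%:R ^+ 2)^-1.
    move=> /gap; rewrite -/x => hg.
    have z0 : 0 < zeta j n by apply: lt_le_trans (zeta_n j n).
    rewrite ler_pdivlMr ?exprn_gt0// ME ler_pdivlMr ?exprn_gt0//.
    rewrite ler_pdivlMr ?exprn_gt0//.
    apply: le_trans (decay (w i - xi s j n)).
    rewrite -/p -/(ht s j n i) [leRHS]mulrC -(mulrA _ (n.+1%:R ^+ 2)).
    rewrite -(mulrA (csq _)).
    apply: ler_wpM2l; first exact: csq_ge0.
    apply: (@le_trans _ _ ((kap * (x + zeta j n)) ^+ (N * 2))); last first.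
      have kz : 0 <= kap * (x + zeta j n).
        by apply: mulr_ge0; [exact: ltW|apply: addr_ge0; exact: ltW].
      have hg' : kap * (x + zeta j n) <= 1 + `|w i - xi s j n|.
        by apply: le_trans hg _; rewrite lerDr.
      by apply: lerXn2r hg'; rewrite nnegrE// (le_trans kz).
    rewrite exprMn [leRHS]mulrC ler_pM2r ?exprn_gt0//.
    have Zx : x <= x + zeta j n by rewrite lerDl ltW.
    have Zn : n.+1%:R <= x + zeta j n.
      by apply: le_trans (zeta_n j n) _; rewrite lerDr ltW.
    have x0' := ltW x0; have Z0' := le_trans x0' Zx.
    rewrite NE exprD; apply: ler_pM.
    - by rewrite exprn_ge0.
    - by rewrite exprn_ge0// ltW.
    - by apply: lerXn2r Zn; rewrite nnegrE.
    - by apply: lerXn2r Zx; rewrite nnegrE.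
  have sumn s j : \sum_(n < Q | ~~ blk s j n i) csq (ht s j n i) <= M * 2.
    apply: (@le_trans _ _ (\sum_(n < Q) M * (n.+1%:R ^+ 2)^-1)).
      rewrite big_mkcond; apply: ler_sum => n _; case: ifPn => [/each//|_].
      by apply: mulr_ge0 => //; rewrite invr_ge0 exprn_ge0.
    by rewrite -mulr_sumr ler_wpM2l// sum_invsq_le.
  have sumall : \sum_(s : bool) \sum_(j < 8) \sum_(n < Q | ~~ blk s j n i) csq (ht s j n i)
      <= M * 32.
    apply: (@le_trans _ _ (\sum_(s : bool) \sum_(j < 8) M * 2)).
      by apply: ler_sum => s _; apply: ler_sum => j _; exact: sumn.
    by rewrite !sumr_const card_bool card_ord -mulrnA -[leLHS]mulr_natr -mulrA -natrM.
  apply: (le_trans (ler_wpM2l (b_ge0 i) sumall)).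
  have bx : b i <= a i * (B * 2 ^+ m * x ^+ m).
    apply: le_trans (b_le i) _; rewrite ler_pM2l// -mulrA ler_wpM2l// -exprMn.
    rewrite lerXn2r ?nnegrE ?addr_ge0 ?mulr_ge0 ?(ltW x0)//; rewrite -/x; lra.
  apply: (@le_trans _ _ (a i * (B * 2 ^+ m * x ^+ m) * (M * 32))).
    by rewrite ler_wpM2r// mulr_ge0.
  rewrite -mulrA ler_pM2l//.
  have -> : B * 2 ^+ m * x ^+ m * (M * 32) = K1 * (x ^+ m / x ^+ (m * 2).+2).
    rewrite ME /K1; field; rewrite !expf_neq0 ?gt_eqF//.
  apply: (@le_trans _ _ (K1 / x)).
    rewrite ler_wpM2l// ler_pdivrMr ?exprn_gt0// ler_pdivlMl// -exprS.
    by rewrite ler_weXn2l// ltnS ltnW// ltnS leq_pmulr.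
  have cp : 0 < c0 / (4 * C * T) by apply: divr_gt0 => //; rewrite !mulr_gt0.
  rewrite ler_pdivrMr// -ler_pdivrMl//.
  have -> : (c0 / (4 * C * T))^-1 * K1 = 4 * C * T * K1 / c0.
    by rewrite invf_div; ring.
  exact: le_trans WK xW.
have tot : \sum_(s : bool) \sum_(j < 8) \sum_(n < Q)
    \sum_(i <- r | blk s j n i) a i * csq (ht s j n i * c i) <=
  \sum_(s : bool) \sum_(j < 8) \sum_(n < Q)
   (2 * C * cint 0 T (f r (fun i => ht s j n i * c i)) +
    2 * C * T * \sum_(i <- r | ~~ blk s j n i) b i * csq (ht s j n i * c i)).
  apply: ler_sum => s _; apply: ler_sum => j _; apply: ler_sum => n _.
  exact: win.
have lower : c0 * \sum_(i <- r) a i * csq (c i) <=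
  \sum_(s : bool) \sum_(j < 8) \sum_(n < Q)
    \sum_(i <- r | blk s j n i) a i * csq (ht s j n i * c i).
  have -> : \sum_(s : bool) \sum_(j < 8) \sum_(n < Q)
      \sum_(i <- r | blk s j n i) a i * csq (ht s j n i * c i) =
    \sum_(i <- r) \sum_(s : bool) \sum_(j < 8) \sum_(n < Q | blk s j n i)
       a i * csq (ht s j n i * c i).
    rewrite [RHS]exchange_big; apply: eq_bigr => s _.
    rewrite [RHS]exchange_big; apply: eq_bigr => j _.
    under [RHS]eq_bigr do rewrite big_mkcond.
    by rewrite [RHS]exchange_big; apply: eq_bigr => n _; rewrite big_mkcond.
  rewrite mulr_sumr big_seq [leRHS]big_seq; apply: ler_sum => i ir.
  have [s [j [n [bn cn]]]] := cover _ ir.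
  have t0 s' j' n' : 0 <= a i * csq (ht s' j' n' i * c i).
    by rewrite mulr_ge0 ?csq_ge0// ltW.
  apply: (@le_trans _ _ (a i * csq (ht s j n i * c i))).
    by rewrite csqM mulrCA ler_pM2l// ler_wpM2r// csq_ge0.
  apply: le_trans (sum_ge_term (P := fun n : 'I_Q => blk s j n i)
    (F := fun n : 'I_Q => a i * csq (ht s j n i * c i)) (fun n _ => t0 s j n) bn) _.
  apply: le_trans (sum_ge_term (P := xpredT) (F := fun j : 'I_8 =>
    \sum_(n < Q | blk s j n i) a i * csq (ht s j n i * c i)) (i := j) _ isT) _.
    by move=> j' _; apply: sumr_ge0.
  apply: (sum_ge_term (P := xpredT) (F := fun s : bool => \sum_(j < 8)
    \sum_(n < Q | blk s j n i) a i * csq (ht s j n i * c i)) (i := s) _ isT).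
  by move=> s' _; apply: sumr_ge0 => j' _; apply: sumr_ge0.
have upp : \sum_(s : bool) \sum_(j < 8) \sum_(n < Q)
   (2 * C * cint 0 T (f r (fun i => ht s j n i * c i)) +
    2 * C * T * \sum_(i <- r | ~~ blk s j n i) b i * csq (ht s j n i * c i)) <=
   32 * C * T * d * I + c0 / 2 * \sum_(i <- r) a i * csq (c i).
  do 3! [under eq_bigr do under eq_bigr do rewrite big_split /= -!mulr_sumr
    | under eq_bigr do rewrite big_split /= -!mulr_sumr
    | rewrite big_split /= -!mulr_sumr].
  apply: lerD.
    apply: (@le_trans _ _ (2 * C * \sum_(s : bool) \sum_(j < 8) (T * (d * I)))).
      rewrite ler_pM2l ?mulr_gt0//; apply: ler_sum => s _; apply: ler_sum => j _.
      exact: bes.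
    rewrite !sumr_const card_bool card_ord -mulrnA -[_ *+ (8 * 2)]mulr_natr; lra.
  have -> : \sum_(s : bool) \sum_(j < 8) \sum_(n < Q)
      \sum_(i <- r | ~~ blk s j n i) b i * csq (ht s j n i * c i) =
    \sum_(i <- r) b i * (\sum_(s : bool) \sum_(j < 8) \sum_(n < Q | ~~ blk s j n i)
       csq (ht s j n i)) * csq (c i).
    under [RHS]eq_bigr do rewrite mulr_sumr mulr_suml.
    rewrite [RHS]exchange_big; apply: eq_bigr => s _.
    under [RHS]eq_bigr do rewrite mulr_sumr mulr_suml.
    rewrite [RHS]exchange_big; apply: eq_bigr => j _.
    under [RHS]eq_bigr do rewrite mulr_sumr mulr_suml big_mkcond.
    rewrite [RHS]exchange_big; apply: eq_bigr => n _; rewrite big_mkcond.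
    by apply: eq_bigr => i _; rewrite csqM mulrA.
  apply: (@le_trans _ _ (2 * C * T * \sum_(i <- r) a i * (c0 / (4 * C * T)) * csq (c i))).
    rewrite ler_pM2l ?mulr_gt0// big_seq [leRHS]big_seq; apply: ler_sum => i ir.
    by rewrite ler_wpM2r ?csq_ge0// err.
  rewrite le_eqVlt; apply/orP; left; apply/eqP.
  rewrite !mulr_sumr; apply: eq_bigr => i _; field.
  by rewrite !gt_eqF.
rewrite mulrAC ler_pdivlMr// -/I.
have := le_trans lower (le_trans tot upp).
set S := \sum_(i <- r) _; lra.
Qed.

Lemma observable_mono (P : pred X) tau tau' : 0 <= tau <= tau' ->
  observable P tau -> observable P tau'.
Proof.
move=> /andP[t0 tt] [C' C'0 H]; exists C' => // r c ur rP.
apply: le_trans (H _ _ ur rP) _; rewrite ler_pM2l//.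
by apply: cint_sub_le.
Qed.

Let finite_lower (s : seq X) (P : pred X) (F : X -> R) : (forall i, P i -> 0 < F i) ->
  exists2 kap, 0 < kap & forall i, i \in s -> P i -> kap <= F i.
Proof.
move=> F0; elim: s => [|i s [kap kap0 ih]]; first by exists 1.
have [Pi|nPi] := boolP (P i).
  exists (Num.min kap (F i)); first by rewrite lt_min kap0 F0.
  move=> j; rewrite inE => /predU1P[-> _|js Pj]; first by rewrite ge_min lexx orbT.
  by rewrite ge_min ih.
exists kap => // j; rewrite inE => /predU1P[->|]; last exact: ih.
by rewrite (negbTE nPi).
Qed.

(** Discreteness makes the set of modes of frequency mu finite, so that unique
    continuation becomes quantitative, with a constant valid for all its
    subsets. *)
Let eigen_lower (mu : R) : exists2 kap, 0 < kap & forall r (c : X -> R[i]), uniq r ->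
  (forall i, i \in r -> w i = mu) ->
  \sum_(i <- r) a i * csq (c i) <= kap * sqnorm (\sum_(i <- r) c i *: g i).
Proof.
have [s' [us' hs']] := discrete `|mu|.
pose s := [seq i <- s' | w i == mu].
have us : uniq s by exact: filter_uniq.
have sw i : i \in s -> w i = mu by rewrite mem_filter => /andP[/eqP].
have ws i : w i = mu -> i \in s by move=> wi; rewrite mem_filter wi eqxx hs' ?wi.
pose v (k : 'I_(size s)) := g (tnth (in_tuple s) k).
have free (c : 'I_(size s) -> R[i]) : \sum_k c k *: v k = 0 -> forall k, c k = 0.
  move=> c0 k.
  pose ct i := oapp c 0 (insub (index i s)).
  have ctE (l : 'I_(size s)) : ct (tnth (in_tuple s) l) = c l.
    rewrite /ct (tnth_nth (tnth (in_tuple s) l)) /= index_uniq// insubT//= => p.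
    by congr c; apply: val_inj.
  rewrite -ctE; apply: (no_eigen us sw); last exact: mem_tnth.
  rewrite -[RHS]c0 [LHS]big_tnth; apply: eq_bigr => l _.
  by rewrite ctE.
have [kap kap0 H] := free_lower_bound hK free.
have [A A0 HA] : exists2 A, 0 < A & forall i, i \in s -> a i <= A.
  have [A A0 HA] := finite_lower s (P := xpredT) (F := fun i => (a i)^-1)
    (fun i _ => ltac:(by rewrite invr_gt0)).
  exists A^-1; first by rewrite invr_gt0.
  by move=> i /HA /(_ isT); rewrite -[X in _ -> X <= _]invrK lef_pV2// posrE invr_gt0.
exists (A / kap); first by rewrite divr_gt0.
move=> r c ur rw.
pose cr i := if i \in r then c i else 0.
have ext (V : zmodType) (F : X -> V) : (forall i, i \notin r -> F i = 0) ->
    \sum_(i <- r) F i = \sum_(i <- s) F i.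
  move=> F0; rewrite [RHS](bigID (mem r)) /= [X in _ = _ + X]big1; last by move=> i; exact: F0.
  rewrite addr0 -[RHS]big_filter; apply: perm_big; apply: uniq_perm => //.
    exact: filter_uniq.
  move=> i; rewrite mem_filter; case ir : (i \in r) => //=.
  by apply/esym/ws/rw.
have -> : \sum_(i <- r) c i *: g i = \sum_k cr (tnth (in_tuple s) k) *: v k.
  transitivity (\sum_(i <- r) cr i *: g i).
    by rewrite big_seq [RHS]big_seq; apply: eq_bigr => i ir; rewrite /cr ir.
  rewrite ext; first by rewrite [LHS]big_tnth.
  by move=> i ir; rewrite /cr (negbTE ir) scale0r.
have csum : \sum_(i <- r) csq (c i) = \sum_k csq (cr (tnth (in_tuple s) k)).
  transitivity (\sum_(i <- r) csq (cr i)).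
    by rewrite big_seq [RHS]big_seq; apply: eq_bigr => i ir; rewrite /cr ir.
  rewrite ext; first by rewrite [LHS]big_tnth.
  by move=> i ir; rewrite /cr (negbTE ir) /csq /= expr0n addr0.
apply: (@le_trans _ _ (A * \sum_(i <- r) csq (c i))).
  rewrite mulr_sumr big_seq [leRHS]big_seq; apply: ler_sum => i ir.
  by rewrite ler_wpM2r ?csq_ge0// HA// ws// rw.
by rewrite -mulrA ler_pM2l// -ler_pdivrMl ?invr_gt0// invrK csum.
Qed.

(** Haraux's device.  The symbol q of the operator that removes mu is bounded below
    on the other frequencies: it is close to [hat p 0] far from mu, and takes
    finitely many nonzero values near mu. *)
Lemma add_frequency (P : pred X) (mu tau d : R) : 0 < d <= 1 -> 0 <= tau ->
  observable (fun i => (w i != mu) && P i) tau -> observable P (tau + d).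
Proof.
move=> /andP[d0 d1] tau0 [C1 C10 HC1].
pose N := m.+1; pose p := window d N.
have p01 s : 0 <= s <= d -> 0 <= p.[s] <= 1.
  by move=> sd; rewrite window_ge0 ?window_le1.
have [CN CN0 decay] := hat_window_decay d0 N.
have H00 := hat_window0_gt0 d0 N.
have h0E := hat_window0 d N.
have neq := hat_window_neq d0 N.
rewrite -/p in decay H00 h0E neq.
set H0 := hatc d p 0 in H00 h0E neq.
clearbody H0; clearbody p.
have [kap kap0 Hkap] : exists2 kap, 0 < kap &
    forall i, w i != mu -> kap <= csq (H0%:C - hat d p (w i - mu)).
  pose W := `|mu| + 4 * CN / H0 ^+ 2.
  have [s [us hs]] := discrete W.
  have [kap kap0 hk] := finite_lower s (P := fun i => w i != mu)
    (F := fun i => csq (H0%:C - hat d p (w i - mu)))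
    (fun i h => neq (w i - mu) ltac:(by rewrite subr_eq0)).
  have H02 : 0 < H0 ^+ 2 / 4 by rewrite divr_gt0// exprn_gt0.
  exists (Num.min kap (H0 ^+ 2 / 4)); first by rewrite lt_min kap0.
  move=> i wi; have [iW|iW] := leP `|w i| W.
    by rewrite ge_min hk ?hs.
  rewrite ge_min; apply/orP; right.
  have x1 : 4 * CN / H0 ^+ 2 <= 1 + `|w i - mu|.
    have := ler_normD (w i - mu) mu; rewrite subrK; move: iW; rewrite /W; lra.
  have small : csq (hat d p (w i - mu)) <= H0 ^+ 2 / 4.
    set x := 1 + _ in x1; have x_ge1 : 1 <= x by rewrite lerDl.
    have x0 : 0 < x by exact: lt_le_trans x_ge1.
    have : x * csq (hat d p (w i - mu)) <= CN.
      apply: le_trans (decay (w i - mu)); rewrite ler_wpM2r ?csq_ge0//.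
      by rewrite -/x -[leLHS]expr1 ler_weXn2l// /N mulSn.
    move: x1; rewrite ler_pdivrMr ?exprn_gt0// => x1 hx.
    have := csq_ge0 (hat d p (w i - mu)); set y := csq _ in hx *; move=> y0.
    rewrite -(ler_pM2l x0); lra.
  have := csqD (H0%:C - hat d p (w i - mu)) (hat d p (w i - mu)).
  rewrite subrK csq_real; lra.
have [C2 C20 HC2] := eigen_lower mu.
have [C3 C3E] : exists x, x = B * (1 + `|mu|) ^+ m * CN by eexists.
have C30 : 0 <= C3 by rewrite C3E !mulr_ge0// exprn_ge0// addr_ge0.
have HC3 i : b i * csq (hat d p (w i - mu)) <= C3 * a i.
  set x := `|w i - mu|; have x0 : 0 <= x by exact: normr_ge0.
  have wx : 1 + `|w i| <= (1 + `|mu|) * (1 + x).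
    have := ler_normD (w i - mu) mu; rewrite subrK -/x.
    have : 0 <= `|mu| * x by rewrite mulr_ge0. lra.
  have x1 : 1 <= 1 + x by rewrite lerDl.
  have hx : (1 + x) ^+ m * csq (hat d p (w i - mu)) <= CN.
    apply: le_trans (decay (w i - mu)); rewrite ler_wpM2r ?csq_ge0//.
    by rewrite -/x ler_weXn2l// /N muln2 -addnn addSn ltnW// ltnS leq_addr.
  apply: (@le_trans _ _ (a i * (B * ((1 + `|mu|) * (1 + x)) ^+ m) * csq (hat d p (w i - mu)))).
    rewrite ler_wpM2r ?csq_ge0//; apply: le_trans (b_le i) _.
    rewrite ler_pM2l// ler_wpM2l// lerXn2r ?nnegrE ?addr_ge0//.
    by rewrite mulr_ge0// addr_ge0.
  rewrite exprMn C3E.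
  have -> : a i * (B * ((1 + `|mu|) ^+ m * (1 + x) ^+ m)) * csq (hat d p (w i - mu)) =
    (a i * B * (1 + `|mu|) ^+ m) * ((1 + x) ^+ m * csq (hat d p (w i - mu))) by ring.
  have -> : B * (1 + `|mu|) ^+ m * CN * a i = (a i * B * (1 + `|mu|) ^+ m) * CN by ring.
  by rewrite ler_wpM2l// !mulr_ge0// ?exprn_ge0 ?addr_ge0// ltW.
have [C4 C4E] : exists x, x = C1 / kap * (2 * H0 ^+ 2 + 2 * tau * d) by eexists.
have C40 : 0 <= C4.
  by rewrite C4E mulr_ge0 ?divr_ge0 ?(ltW C10) ?(ltW kap0)// addr_ge0 ?mulr_ge0 ?sqr_ge0// ltW.
have [C5 C5E] : exists x, x = C2 / H0 ^+ 2 * (2 * d + 2 * C3 * C4) by eexists.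
have C50 : 0 <= C5.
  rewrite C5E; apply: mulr_ge0; first by rewrite divr_ge0 ?sqr_ge0// ltW.
  by rewrite addr_ge0// ?mulr_ge0// ltW.
exists (C4 + C5 + 1); first by rewrite ltr_wpDl// addr_ge0.
move=> r c ur rP.
pose I := cint 0 (tau + d) (f r c); rewrite -/I.
have I0 : 0 <= I by apply: cint_ge0.
pose F t := trig w g r (fun i => hat d p (w i - mu) * c i) t.
have FI t : 0 <= t <= tau -> sqnorm (F t) <= d * I.
  move=> tt; have := @window_bessel _ _ _ hK _ w g d tau t p 'I_1 (fun=> mu) r c d0 tt p01.
  rewrite big_ord1 => H; apply: H => y y'.
  by rewrite (ord1 y) (ord1 y') eqxx.
pose q i := H0%:C - hat d p (w i - mu).
pose r1 := [seq i <- r | w i != mu].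
pose r0 := [seq i <- r | ~~ (w i != mu)].
have ur1 : uniq r1 by exact: filter_uniq.
have ur0 : uniq r0 by exact: filter_uniq.
have r0w i : i \in r0 -> w i = mu.
  by rewrite mem_filter negbK => /andP[/eqP].
have split (u : X -> R[i]) t : trig w g r u t = trig w g r1 u t + trig w g r0 u t.
  exact: trig_split.
have r0q u t : trig w g r0 (fun i => q i * u i) t = 0.
  rewrite /trig big_seq big1// => i /r0w wi.
  by rewrite /q wi subrr h0E subrr mul0r mulr0 scale0r.
have qE t : trig w g r1 (fun i => q i * c i) t = H0%:C *: trig w g r c t + (-1) *: F t.
  have := split (fun i => q i * c i) t; rewrite r0q addr0 => <-.
  rewrite /F /trig !scaler_sumr -big_split; apply: eq_bigr => i _.
  by rewrite /= !scalerA -scalerDl; congr (_ *: _); rewrite /q; ring.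
have high : \sum_(i <- r1) a i * csq (c i) <= C4 * I.
  have r1P : all (fun i => (w i != mu) && P i) r1.
    by apply/allP => i; rewrite mem_filter => /andP[-> /(allP rP)].
  have := HC1 r1 (fun i => q i * c i) ur1 r1P.
  have lo : kap * \sum_(i <- r1) a i * csq (c i) <= \sum_(i <- r1) a i * csq (q i * c i).
    rewrite mulr_sumr big_seq [leRHS]big_seq; apply: ler_sum => i.
    rewrite mem_filter => /andP[wi _]; rewrite csqM mulrCA ler_pM2l//.
    by rewrite ler_wpM2r ?csq_ge0// Hkap.
  move=> /(le_trans lo) {}lo.
  rewrite -(ler_pM2l kap0); apply: le_trans lo _.
  have -> : kap * (C4 * I) = C1 * ((2 * H0 ^+ 2 + 2 * tau * d) * I).
    by rewrite C4E; field; rewrite gt_eqF.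
  rewrite ler_pM2l//.
  apply: (@le_trans _ _ (cint 0 tau (fun t => 2 * H0 ^+ 2 * sqnorm (trig w g r c t) + 2 * (d * I)))).
    apply: le_cint => //.
      apply: continuous_addf; [exact: continuous_scale|exact: cst_continuous].
    move=> t tt; rewrite qE; apply: le_trans (sqnormD hK _ _) _.
    rewrite !(sqnormZ hK) csq_real.
    by rewrite csqN1 mul1r mulrA lerD2l ler_pM2l// FI.
  rewrite cintD; [|exact: continuous_scale|exact: cst_continuous].
  rewrite cintZ// cint_cst// subr0.
  have : cint 0 tau (f r c) <= I.
    by apply: cint_sub_le => //; rewrite lerDl ltW.
  move=> /(ler_wpM2l (mulr_ge0 (ler0n _ 2) (sqr_ge0 H0))); lra.
have low : \sum_(i <- r0) a i * csq (c i) <= C5 * I.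
  apply: le_trans (HC2 _ _ ur0 r0w) _.
  have := split (fun i => hat d p (w i - mu) * c i) 0.
  rewrite -/(F 0) => FE.
  have e0 : trig w g r0 (fun i => hat d p (w i - mu) * c i) 0 =
      H0%:C *: \sum_(i <- r0) c i *: g i.
    rewrite /trig scaler_sumr big_seq [RHS]big_seq; apply: eq_bigr => i /r0w wi.
    by rewrite wi subrr h0E mulr0 expi0 mul1r scalerA.
  have : sqnorm (H0%:C *: \sum_(i <- r0) c i *: g i) <=
      2 * (d * I) + 2 * (C3 * (C4 * I)).
    rewrite -e0.
    have -> : trig w g r0 (fun i => hat d p (w i - mu) * c i) 0 =
        F 0 + (-1) *: trig w g r1 (fun i => hat d p (w i - mu) * c i) 0.
      by rewrite FE scaleN1r addrAC subrr add0r.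
    apply: le_trans (sqnormD hK _ _) _; rewrite (sqnormZ hK).
    rewrite csqN1 mul1r lerD// ler_pM2l//; first by apply: FI; rewrite lexx.
    apply: le_trans (trig_upper _ _ ur1) _.
    apply: (@le_trans _ _ (C3 * \sum_(i <- r1) a i * csq (c i))).
      rewrite mulr_sumr; apply: ler_sum => i _.
      by rewrite csqM !mulrA ler_wpM2r ?csq_ge0.
    by rewrite ler_wpM2l.
  rewrite (sqnormZ hK) csq_real -ler_pdivlMl ?exprn_gt0// => hS.
  apply: le_trans (ler_wpM2l (ltW C20) hS) _.
  by rewrite le_eqVlt C5E; apply/orP; left; apply/eqP; ring.
rewrite (bigID (fun i => w i != mu)) /= -[X in X + _]big_filter
  -[X in _ + X]big_filter -/r1 -/r0.
by move: high low; lra.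
Qed.

(** The extra time tau - T is spent on the windows at high frequency and on the
    finitely many low frequencies, at most half of what remains at each step. *)
Theorem full_observability (tau : R) : T < tau -> observable xpredT tau.
Proof.
move=> Ttau.
have step : forall (l : seq R) t d, 0 < d -> 0 <= t ->
    observable (fun i => w i \notin l) t -> observable xpredT (t + d).
  elim=> [|mu l ih] t d d0 t0.
    by apply: observable_mono; rewrite t0 lerDl ltW.
  move=> H; pose e := Num.min (d / 2) 1.
  have e0 : 0 < e by rewrite lt_min divr_gt0/=.
  have e1 : e <= 1 by rewrite ge_min lexx orbT.
  have ed : e < d by rewrite gt_min; apply/orP; left; lra.
  have -> : t + d = t + e + (d - e) by ring.
  apply: ih; first by rewrite subr_gt0.
    by rewrite addr_ge0// ltW.
  apply: (@add_frequency _ mu); rewrite ?e0 ?e1//.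
  case: H => C' C'0 H; exists C' => // r c ur rP; apply: H => //.
  by apply: sub_all rP => i; rewrite inE negb_or.
pose e := Num.min ((tau - T) / 2) 1.
have e0 : 0 < e by rewrite lt_min divr_gt0//= subr_gt0.
have e1 : e <= 1 by rewrite ge_min lexx orbT.
have ed : e < tau - T by rewrite gt_min; apply/orP; left; lra.
have [W [C' C'0 HW]] : exists W, observable (fun i => W <= `|w i|) (T + e).
  by apply: high_frequency; rewrite e0 e1.
have [s [us hs]] := discrete W.
have -> : tau = T + e + (tau - T - e) by ring.
apply: (step (map w s)); first lra.
  by rewrite addr_ge0// ltW.
exists C' => // r c ur rs; apply: HW => //.
apply: sub_all rs => i /=; rewrite leNgt; apply: contra => /ltW/hs is_.
exact: map_f.
Qed.

End Observability.

(** * The scale of spaces D(A^s) and the observation operator *)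

Section Series.
Context {R : realType}.
Implicit Types h : nat -> R.

Lemma nneseries_le h x : (forall n, 0 <= h n) ->
  (forall N, \sum_(n < N) h n <= x) -> (\sum_(0 <= n <oo) (h n)%:E <= x%:E)%E.
Proof.
move=> h0 hx; apply: lime_le; first by apply: is_cvg_nneseries => n _ _; rewrite lee_fin.
by near=> N; rewrite sumEFin lee_fin big_mkord.
Unshelve. all: by end_near. Qed.

Lemma nneseries_ge h N : (forall n, 0 <= h n) ->
  ((\sum_(n < N) h n)%:E <= \sum_(0 <= n <oo) (h n)%:E)%E.
Proof.
move=> h0; have := @nneseries_lim_ge R (fun n => (h n)%:E) xpredT 0%N N.
by rewrite sumEFin big_mkord; apply => n _ _; rewrite lee_fin.
Qed.

Lemma nneseries_finsupp h (s : seq nat) : (forall n, 0 <= h n) -> uniq s ->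
  (forall n, n \notin s -> h n = 0) ->
  (\sum_(0 <= n <oo) (h n)%:E = (\sum_(n <- s) h n)%:E)%E.
Proof.
move=> h0 us hs.
have sumE N : (forall n, n \in s -> (n < N)%N) -> \sum_(n < N) h n = \sum_(n <- s) h n.
  move=> sN; rewrite -(big_mkord xpredT h) (bigID (mem s)) /= [X in _ + X]big1; last first.
    by move=> n; exact: hs.
  rewrite addr0 -big_filter; apply: perm_big; apply: uniq_perm => //.
    by rewrite filter_uniq// iota_uniq.
  move=> n; rewrite mem_filter mem_index_iota /=.
  by case ns : (n \in s) => //=; apply: sN.
have [M sM] : exists M, forall n, n \in s -> (n < M)%N.
  exists (\max_(n <- s) n).+1 => n ns; rewrite ltnS.
  by rewrite (bigD1_seq n)//= leq_maxl.
apply/eqP; rewrite eq_le; apply/andP; split.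
- apply: nneseries_le => // N; rewrite -(sumE (maxn N M)).
    rewrite -!(big_mkord xpredT h) [leRHS](big_cat_nat (n := N))//= ?leq_maxl// lerDl.
    exact: sumr_ge0.
  by move=> n /sM h1; rewrite leq_max h1 orbT.
- by rewrite -(sumE M)//; exact: nneseries_ge.
Qed.

End Series.

Section ScaleLemmas.
Context {R : realType} (lambda : nat -> R).
Implicit Types (u v : nat -> R[i]^o) (s t : R).

Lemma powR_sqr n s : (lambda n `^ s) ^+ 2 = lambda n `^ (2 * s).
Proof. by rewrite -powR_mulrn ?powR_ge0// -powRrM mulrC. Qed.

Lemma DA_norm2E s u : DA_norm2 lambda s u =
  (\sum_(0 <= n <oo) (lambda n `^ (2 * s) * csq (u n))%:E)%E.
Proof.
apply: eq_eseriesr => n _; congr EFin.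
by rewrite rnorm_csq /powA csqM csq_real powR_sqr.
Qed.

Lemma DA_term_ge0 s u n : 0 <= lambda n `^ s * csq (u n).
Proof. by rewrite mulr_ge0 ?powR_ge0 ?csq_ge0. Qed.

Lemma DA_norm2_le s u x :
  (forall N, \sum_(n < N) lambda n `^ (2 * s) * csq (u n) <= x) ->
  (DA_norm2 lambda s u <= x%:E)%E.
Proof. by move=> h; rewrite DA_norm2E; apply: nneseries_le => // n; exact: DA_term_ge0. Qed.

Lemma DA_norm2_ge s u N :
  ((\sum_(n < N) lambda n `^ (2 * s) * csq (u n))%:E <= DA_norm2 lambda s u)%E.
Proof.
rewrite DA_norm2E.
by apply: (nneseries_ge (h := fun n => lambda n `^ (2 * s) * csq (u n))) => n; exact: DA_term_ge0.
Qed.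

Lemma DA_term_le s u n :
  ((lambda n `^ (2 * s) * csq (u n))%:E <= DA_norm2 lambda s u)%E.
Proof.
apply: le_trans (DA_norm2_ge s u n.+1); rewrite lee_fin big_ord_recr /= lerDr.
by apply: sumr_ge0 => i _; exact: DA_term_ge0.
Qed.

Lemma DA_norm2_ge0 s u : (0 <= DA_norm2 lambda s u)%E.
Proof. by apply: le_trans (DA_norm2_ge s u 0); rewrite big_ord0. Qed.

Lemma DA_norm_sqr s u : DA lambda s u ->
  ((DA_norm lambda s u ^+ 2)%:E = DA_norm2 lambda s u)%E.
Proof.
move=> Du; rewrite /DA_norm sqr_sqrtr ?fine_ge0 ?DA_norm2_ge0// fineK//.
by rewrite ge0_fin_numE ?DA_norm2_ge0.
Qed.

Lemma DA_norm2_finsupp s u (r : seq nat) : uniq r -> (forall n, n \notin r -> u n = 0) ->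
  DA_norm2 lambda s u = (\sum_(n <- r) lambda n `^ (2 * s) * csq (u n))%:E.
Proof.
move=> ur hu; rewrite DA_norm2E.
apply: (nneseries_finsupp (h := fun n => lambda n `^ (2 * s) * csq (u n))) => //.
  by move=> n; exact: DA_term_ge0.
by move=> n /hu ->; rewrite /csq /= expr0n addr0 mulr0.
Qed.

Definition unit_coef (n : nat) : nat -> R[i]^o := fun k => (n == k)%:R.

Definition fin_coef (I : Type) (r : seq I) (k : I -> nat) (c : I -> R[i]) : nat -> R[i]^o :=
  \sum_(i <- r) c i *: unit_coef (k i).

Lemma fin_coefE (I : Type) (r : seq I) k (c : I -> R[i]) n :
  fin_coef r k c n = \sum_(i <- r | k i == n) c i.
Proof.
rewrite /fin_coef; elim: r => [|i r ih]; first by rewrite !big_nil.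
rewrite !big_cons fctE /= [X in _ + X]ih.
rewrite (_ : (c i *: unit_coef (k i)) n = c i * (k i == n)%:R)//.
by case: (k i == n); rewrite ?mulr1 ?mulr0 ?add0r.
Qed.

Lemma uniq_map_inj (I : eqType) (r : seq I) (k : I -> nat) :
  uniq (map k r) -> {in r &, injective k}.
Proof.
elim: r => [|x r ih] //= /andP[nx ur] i j; rewrite !inE.
move=> /predU1P[->|ir] /predU1P[->|jr] // e; last exact: ih.
  by case/negP: nx; rewrite e map_f.
by case/negP: nx; rewrite -e map_f.
Qed.

Lemma fin_coef_inj (I : eqType) (r : seq I) k (c : I -> R[i]) i :
  uniq (map k r) -> i \in r -> fin_coef r k c (k i) = c i.
Proof.
move=> ur ir; rewrite fin_coefE big_mkcond (bigD1_seq i)//=; last exact: map_uniq ur.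
rewrite eqxx big_seq_cond big1 ?addr0// => j /andP[jr ji].
case: eqP => // kij.
by case/negP: ji; apply/eqP/(uniq_map_inj ur).
Qed.

Lemma fin_coef_notin (I : eqType) (r : seq I) k (c : I -> R[i]) n :
  n \notin map k r -> fin_coef r k c n = 0.
Proof.
move=> nr; rewrite fin_coefE big_seq_cond big1// => i /andP[ir /eqP kn].
by case/negP: nr; rewrite -kn map_f.
Qed.

Lemma DA_norm2_fin_coef s (I : eqType) (r : seq I) k (c : I -> R[i]) :
  uniq (map k r) -> DA_norm2 lambda s (fin_coef r k c) =
  (\sum_(i <- r) lambda (k i) `^ (2 * s) * csq (c i))%:E.
Proof.
move=> ur; rewrite (DA_norm2_finsupp _ ur); last by move=> n; exact: fin_coef_notin.
rewrite big_map; congr EFin; rewrite big_seq [RHS]big_seq.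
by apply: eq_bigr => i ir; rewrite fin_coef_inj.
Qed.

Section LinearOperator.
Variables (K : completeNormedModType R[i]) (m0 C0 : R) (L : (nat -> R[i]^o) -> K).
Hypothesis hL_lin : linear_operator (DA lambda m0) L.
Hypothesis hL_bnd : forall u, DA lambda m0 u -> rnorm (L u) <= C0 * DA_norm lambda m0 u.

Lemma DA_lin (a : R[i]) u v : DA lambda m0 u -> DA lambda m0 v -> DA lambda m0 (a *: u + v).
Proof. by case: hL_lin => _ h _; exact: h. Qed.

Lemma L_lin (a : R[i]) u v : DA lambda m0 u -> DA lambda m0 v ->
  L (a *: u + v) = a *: L u + L v.
Proof. by case: hL_lin => _ _ h; exact: h. Qed.

Lemma DA0 : DA lambda m0 0. Proof. by case: hL_lin. Qed.

Lemma L0 : L 0 = 0.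
Proof.
have := L_lin 1 DA0 DA0; rewrite !scale1r addr0 => h.
by apply: (addrI (L 0)); rewrite addr0.
Qed.

Lemma DA_unit n : DA lambda m0 (unit_coef n).
Proof.
rewrite /DA /= (@DA_norm2_finsupp _ _ [:: n])// ?ltry// => k.
by rewrite inE /unit_coef eq_sym => /negbTE ->.
Qed.

Lemma DA_fin_coef (I : Type) (r : seq I) k (c : I -> R[i]) :
  DA lambda m0 (fin_coef r k c).
Proof.
rewrite /fin_coef; elim: r => [|i r ih]; first by rewrite big_nil; exact: DA0.
by rewrite big_cons; apply: DA_lin => //; exact: DA_unit.
Qed.

Lemma L_fin_coef (I : Type) (r : seq I) k (c : I -> R[i]) :
  L (fin_coef r k c) = \sum_(i <- r) c i *: L (unit_coef (k i)).
Proof.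
rewrite /fin_coef; elim: r => [|i r ih]; first by rewrite !big_nil L0.
rewrite !big_cons L_lin ?ih//; first exact: DA_unit.
exact: DA_fin_coef.
Qed.

Lemma L_bound u x : (DA_norm2 lambda m0 u <= x%:E)%E -> sqnorm (L u) <= C0 ^+ 2 * x.
Proof.
move=> ux; have Du : DA lambda m0 u by exact: le_lt_trans ux (ltry _).
have := hL_bnd Du; move: ux; rewrite -(DA_norm_sqr Du) lee_fin => ux h.
apply: (@le_trans _ _ ((C0 * DA_norm lambda m0 u) ^+ 2)).
  have r0 : 0 <= rnorm (L u).
    by rewrite /rnorm; have : 0 <= `|L u| by []; rewrite lecE => /andP[].
  by rewrite /sqnorm lerXn2r ?nnegrE// (le_trans r0).
by rewrite exprMn ler_wpM2l ?sqr_ge0.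
Qed.

End LinearOperator.
End ScaleLemmas.

(** * Modes of the wave equation *)

Section Modes.
Context {R : realType} (lambda : nat -> R).
Hypothesis lambda_gt0 : forall n, 0 < lambda n.

(** A mode is a basis vector together with a direction of rotation: [true] stands
    for e^(-i t sqrt lambda_n). *)
Definition freq (i : bool * nat) : R := (-1) ^+ i.1 * Num.sqrt (lambda i.2).

Lemma sqrt_gt0 n : 0 < Num.sqrt (lambda n).
Proof. by rewrite sqrtr_gt0. Qed.

Lemma norm_freq i : `|freq i| = Num.sqrt (lambda i.2).
Proof. by rewrite /freq normrM normrX normrN1 expr1n mul1r gtr0_norm// sqrt_gt0. Qed.

Lemma freq_sign i j : 0 < freq i * freq j -> i.1 = j.1.
Proof.
rewrite /freq mulrACA -signr_addb pmulr_lgt0 ?mulr_gt0 ?sqrt_gt0//.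
by case: i.1; case: j.1 => //=; rewrite expr1 oppr_gt0 ltr10.
Qed.

Lemma uniq_snd (r : seq (bool * nat)) : uniq r ->
  {in r &, forall i j, i.1 = j.1} -> uniq (map snd r).
Proof.
move=> ur h; rewrite map_inj_in_uniq// => -[s n] [s' n'] ir jr /= e.
by have /= -> := h _ _ ir jr; rewrite e.
Qed.

Lemma freq_discrete : lambda @ \oo --> +oo -> forall W : R,
  exists s : seq (bool * nat), uniq s /\ forall i, `|freq i| <= W -> i \in s.
Proof.
move=> loo W; have /cvgryPgt/(_ (W ^+ 2))[N _ hN] := loo.
exists [seq (b, n) | b <- [:: true; false], n <- iota 0 N]; split.
  by apply: allpairs_uniq => //; [exact: iota_uniq|move=> [? ?] [? ?] _ _ /= [-> ->]].
move=> [b n]; rewrite norm_freq => nW.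
apply: (allpairs_f pair); first by case: (b).
rewrite mem_iota add0n /= ltnNge; apply/negP => /hN /=.
rewrite ltNge => /negP; apply; rewrite -(sqr_sqrtr (ltW (lambda_gt0 n))).
by rewrite lerXn2r ?nnegrE ?sqrtr_ge0// (le_trans (sqrtr_ge0 _) nW).
Qed.

Lemma powR_weight (x y : R) n (m : nat) : 2 * (y - x) <= m%:R -> x <= y ->
  lambda n `^ y <= lambda n `^ x * (1 + Num.sqrt (lambda n)) ^+ m.
Proof.
move=> xm xy; have l0 := lambda_gt0 n.
have q0 : 0 <= Num.sqrt (lambda n) by exact: sqrtr_ge0.
rewrite -{1}(subrK x y) addrC powRD; last by rewrite (gt_eqF l0) implybT.
rewrite ler_pM2l ?powR_gt0//.
apply: (@le_trans _ _ ((1 + Num.sqrt (lambda n)) `^ (2 * (y - x)))).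
  rewrite powRrM powR_mulrn ?addr_ge0//.
  apply: ge0_ler_powR; rewrite ?subr_ge0 ?nnegrE ?exprn_ge0 ?addr_ge0// ?(ltW l0)//.
  rewrite -[leLHS](sqr_sqrtr (ltW l0)) lerXn2r ?nnegrE ?addr_ge0// lerDr//.
rewrite -powR_mulrn ?addr_ge0//; apply: ler_powR => //.
by rewrite lerDl.
Qed.

End Modes.

(** * From blocks of half waves to finite sums of modes *)

Section Wave.
Context {R : realType} {E : completeNormedModType R[i]} (dotE : {dot E for Num.conj}).
Variables (DomA : set E) (A : E -> E) (e : nat -> E) (lambda : nat -> R).
Hypothesis hA_lin : linear_operator DomA A.
Hypothesis he : eigenbasis dotE DomA A e lambda.
Variables (alpha rho : R).
Hypothesis halpha : 0 < alpha < 1.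
Hypothesis hrho : 1 < rho < alpha^-1.
Variables (K : completeNormedModType R[i]) (dotK : {dot K for Num.conj}).
Hypothesis hK : hilbert_norm dotK.
Variables (m0 C0 : R) (L : (nat -> R[i]^o) -> K).
Hypothesis hL_lin : linear_operator (DA lambda m0) L.
Hypothesis hL_bnd : forall u, DA lambda m0 u -> rnorm (L u) <= C0 * DA_norm lambda m0 u.
Variables (l1 : R).
Hypothesis hl1 : l1 <= 2 * m0.
Variables (C : R) (k0 : nat) (T : R).
Hypothesis hC : 0 < C.
Hypothesis hk0 : (0 < k0)%N.
Hypothesis hT : 0 < T.
Hypothesis hobs : forall U : int -> E, dyadic_ball lambda alpha rho e U ->
    forall k : int, k != 0 -> (k0 <= `|k|)%N ->
    forall t : R,
      (energy lambda l1 (half_wave lambda k (coefficients dotE e (U k))) t <=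
       C%:E * observed L T (half_wave lambda k (coefficients dotE e (U k))))%E.
Hypothesis huc : forall v : E, eigenvector DomA A v ->
  L (coefficients dotE e v) = 0 -> v = 0.

Let lambda_gt0 n : 0 < lambda n.
Proof. by case: he => _ [h _]; have [] := h n. Qed.

Let dot_e m n : dotE (e m) (e n) = (m == n)%:R.
Proof. by case: he => -[h _] _. Qed.

Local Notation w := (freq lambda).
Let g (i : bool * nat) : K := L (unit_coef i.2).
Let a (i : bool * nat) : R := lambda i.2 `^ l1.
Let b (i : bool * nat) : R := 2 * C0 ^+ 2 * lambda i.2 `^ (2 * m0).

Let coefs_sum (r : seq (bool * nat)) (c : bool * nat -> R[i]) :
  coefficients dotE e (\sum_(i <- r) c i *: e i.2) = fin_coef r snd c.
Proof.
apply/funext => n; rewrite fin_coefE /coefficients dot_suml [RHS]big_mkcond.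
apply: eq_bigr => i _; rewrite (dotZl dotE) dot_e.
by case: (i.2 == n); rewrite ?mulr1 ?mulr0.
Qed.

(** Two modes of opposite rotation share a basis vector; they are bounded
    separately, which costs the factor 2 in b. *)
Let upper r (c : bool * nat -> R[i]) : uniq r ->
  sqnorm (\sum_(i <- r) c i *: g i) <= \sum_(i <- r) b i * csq (c i).
Proof.
move=> ur.
have one (s : bool) : sqnorm (\sum_(i <- r | i.1 == s) c i *: g i) <=
    C0 ^+ 2 * \sum_(i <- r | i.1 == s) lambda i.2 `^ (2 * m0) * csq (c i).
  rewrite -!(big_filter r); set rs := [seq i <- r | _].
  have us : uniq (map snd rs).
    apply: uniq_snd; first exact: filter_uniq.
    by move=> i j; rewrite !mem_filter => /andP[/eqP-> _] /andP[/eqP-> _].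
  rewrite -(L_fin_coef hL_lin rs snd c).
  by apply: (L_bound hL_bnd); rewrite DA_norm2_fin_coef.
rewrite (bigID (fun i => i.1 == true)) /= [leRHS](bigID (fun i => i.1 == true)) /=.
have nb (i : bool * nat) : (i.1 != true) = (i.1 == false) by case: i.1.
rewrite !(eq_bigl _ _ nb).
apply: le_trans (sqnormD hK _ _) _; apply: lerD.
- apply: (@le_trans _ _ (2 * (C0 ^+ 2 * \sum_(i <- r | i.1 == true) lambda i.2 `^ (2 * m0) * csq (c i)))).
    by rewrite ler_pM2l.
  by rewrite mulrA mulr_sumr; apply: ler_sum => i _; rewrite /b mulrA.
- apply: (@le_trans _ _ (2 * (C0 ^+ 2 * \sum_(i <- r | i.1 == false) lambda i.2 `^ (2 * m0) * csq (c i)))).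
    by rewrite ler_pM2l.
  by rewrite mulrA mulr_sumr; apply: ler_sum => i _; rewrite /b mulrA.
Qed.

(** Modes of one frequency rotate in one direction, so they give distinct basis
    vectors, and a combination of them is an eigenvector of A. *)
Let no_eigen r (c : bool * nat -> R[i]) mu : uniq r ->
  (forall i, i \in r -> w i = mu) -> \sum_(i <- r) c i *: g i = 0 ->
  forall i, i \in r -> c i = 0.
Proof.
move=> ur rw cg.
have us : uniq (map snd r).
  apply: uniq_snd => // i j ir jr; apply: (freq_sign lambda_gt0).
  by rewrite (rw i)// (rw j)// -(rw i)// -expr2 exprn_even_gt0//= -normr_gt0 norm_freq// sqrt_gt0.
have lE i : i \in r -> lambda i.2 = mu ^+ 2.
  move=> ir; rewrite -(rw i)// -real_normK ?num_real// norm_freq//.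
  by rewrite sqr_sqrtr// ltW.
pose v := \sum_(i <- r) c i *: e i.2.
have vcoef := coefs_sum r c; rewrite -/v in vcoef.
have [D0 Dlin Alin] := hA_lin.
have De n : DomA (e n) by case: he => _ [h _]; have [] := h n.
have Ae n : A (e n) = (lambda n)%:C *: e n by case: he => _ [h _]; have [] := h n.
have [Dv Av] : DomA v /\ A v = (mu ^+ 2)%:C *: v.
  rewrite /v; elim: (r) (lE) => [_|i r' ih lE'].
    rewrite big_nil scaler0; split => //.
    have := Alin 1 0 0 D0 D0; rewrite !scale1r addr0 => h.
    by apply: (addrI (A 0)); rewrite addr0.
  have [j jr|Dv Av] := ih; first by apply: lE'; rewrite inE jr orbT.
  rewrite big_cons; split; first exact: Dlin.
  by rewrite Alin// Av Ae lE' ?mem_head// scalerDr !scalerA mulrC.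
have v0 : v = 0.
  have [//|vn0] := eqVneq v 0; apply: huc.
    by split => //; exists (mu ^+ 2)%:C.
  by rewrite vcoef (L_fin_coef hL_lin).
move=> i ir; rewrite -(fin_coef_inj c us ir) -vcoef v0 /coefficients.
exact: linear0l.
Qed.

(** The hypothesis on dyadic blocks, for data in the unit ball.  A window lies in a
    block of index k or -k according to the direction of rotation. *)
Let block_small (k : nat) (s : bool) r (c : bool * nat -> R[i]) :
  (k0 <= k)%N -> uniq r ->
  (forall i, i \in r -> alpha * rho ^+ k <= (-1) ^+ s * w i < rho ^+ k / alpha) ->
  rnorm (\sum_(i <- r) c i *: e i.2) <= 1 ->
  \sum_(i <- r) a i * csq (c i) <= 2 * C * cint 0 T (fun t => sqnorm (trig w g r c t)).
Proof.
move=> kk ur hr; set v := \sum_(i <- r) _ => v1.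
have k_gt0 : (0 < k)%N := leq_trans hk0 kk.
have q0 : 0 < alpha * rho ^+ k.
  by case/andP: halpha => a0 _; case/andP: hrho => r1 _; rewrite mulr_gt0// exprn_gt0//; lra.
have rs i : i \in r -> i.1 = s.
  move=> /hr/andP[/(lt_le_trans q0)]; rewrite /freq mulrA -signr_addb.
  rewrite pmulr_lgt0 ?sqrt_gt0//; case: (i.1); case: (s) => //=; rewrite expr1 oppr_gt0 ltr10//.
have us : uniq (map snd r).
  by apply: uniq_snd => // i j /rs-> /rs->.
pose k' : int := (-1) ^+ s * k%:Z.
have k'abs : `|k'|%N = k by rewrite /k' abszMsign absz_nat.
have k'0 : k' != 0 by rewrite -absz_eq0 k'abs -lt0n.
have k'sg : Num.sg (k'%:~R : R) = (-1) ^+ s.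
  have -> : k'%:~R = (-1) ^+ s * k%:R :> R by rewrite /k' rmorphM rmorph_sign.
  rewrite sgrM [X in _ * X]gtr0_sg ?mulr1 ?ltr0n//.
  by case: (s); rewrite ?sgrN ?expr1 ?expr0 ?sgr1 ?sgrN1.
pose U (j : int) : E := if j == k' then v else 0.
have UB : dyadic_ball lambda alpha rho e U.
  move=> j _; rewrite /U; case: eqP => [->|_]; last first.
    split; last by rewrite /rnorm normr0.
    exists (fun=> 0); rewrite fsbig1// => n _; exact: scale0r.
  split => //; exists (fun n => fin_coef r snd c n).
  rewrite (fsbigE (map snd r))//=.
  - rewrite big_map /v big_seq [RHS]big_seq_cond; apply: eq_big => i.
    + case ir : (i \in r) => //=; apply/esym/mem_set; rewrite /J /= k'abs.
      have := hr _ ir; rewrite /freq (rs _ ir) mulrA -signr_addb addbb mul1r.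
      by move=> /andP[-> ->].
    + by move=> ir; rewrite fin_coef_inj.
  - move=> n /= /mapP[i ir ->]; rewrite /J /= k'abs.
    by have := hr _ ir; rewrite /freq (rs _ ir) mulrA -signr_addb addbb mul1r.
  - by move=> n _ nr; rewrite fin_coef_notin// scale0r.
have := hobs UB k'0; rewrite k'abs => /(_ kk 0).
rewrite {1 2}/U eqxx /v coefs_sum.
have hwE t : half_wave lambda k' (fin_coef r snd c) t =
    fin_coef r snd (fun i => expi (w i * t) * c i).
  apply/funext => n; rewrite /half_wave !fin_coefE k'sg mulr_sumr.
  rewrite big_seq_cond [RHS]big_seq_cond; apply: eq_bigr => i /andP[ir /eqP <-].
  by rewrite /freq (rs _ ir) mulrAC.
have Lhw t : L (half_wave lambda k' (fin_coef r snd c) t) = trig w g r c t.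
  by rewrite hwE (L_fin_coef hL_lin).
have -> : observed L T (half_wave lambda k' (fin_coef r snd c)) =
    (cint 0 T (fun t => sqnorm (trig w g r c t)))%:E.
  rewrite -EFin_cint; last exact: (continuous_sqnorm_trig hK).
  by apply: eq_integral => t _; rewrite Lhw.
rewrite -EFinM => H.
have : ((2^-1 * \sum_(i <- r) a i * csq (c i))%:E <=
    energy lambda l1 (half_wave lambda k' (fin_coef r snd c)) 0)%E.
  rewrite /energy EFinM lee_pmul2l//.
  rewrite hwE DA_norm2_fin_coef//.
  have -> : \sum_(i <- r) a i * csq (c i) =
     \sum_(i <- r) lambda i.2 `^ (2 * (l1 / 2)) * csq (expi (w i * 0) * c i).
    apply: eq_bigr => i _; rewrite mulr0 expi0 mul1r /a; congr (_ `^ _ * _).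
    by field.
  by rewrite leeDl// DA_norm2_ge0.
move=> /le_trans/(_ H); rewrite lee_fin => H2.
rewrite -(@ler_pM2l _ 2^-1) ?invr_gt0//; apply: le_trans H2 _.
by rewrite -[2 * C * _]mulrA mulKf.
Qed.

(** Homogeneity removes the restriction to the unit ball. *)
Let block_obs (k : nat) (s : bool) r (c : bool * nat -> R[i]) :
  (k0 <= k)%N -> uniq r ->
  (forall i, i \in r -> alpha * rho ^+ k <= (-1) ^+ s * w i < rho ^+ k / alpha) ->
  \sum_(i <- r) a i * csq (c i) <= 2 * C * cint 0 T (fun t => sqnorm (trig w g r c t)).
Proof.
move=> kk ur hr; set v := \sum_(i <- r) c i *: e i.2.
have v0 : 0 <= rnorm v.
  by rewrite /rnorm; have : 0 <= `|v| by []; rewrite lecE => /andP[].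
pose eps := (1 + rnorm v)^-1.
have e0 : 0 < eps by rewrite invr_gt0 ltr_pwDl.
have small : rnorm (\sum_(i <- r) (eps%:C * c i) *: e i.2) <= 1.
  rewrite (eq_bigr (fun i => eps%:C *: (c i *: e i.2))); last first.
    by move=> i _; rewrite scalerA.
  rewrite -scaler_sumr -/v /rnorm normrZ cReM normc_def /= expr0n addr0 mul0r subr0.
  rewrite sqrtr_sqr gtr0_norm// -/(rnorm v) mulrC ler_pdivrMr ?ltr_pwDl// mul1r.
  by rewrite lerDr.
have := block_small kk ur hr small.
have -> : (fun t => sqnorm (trig w g r (fun i => eps%:C * c i) t)) =
    (fun t => eps ^+ 2 * sqnorm (trig w g r c t)).
  apply/funext => t; rewrite -csq_real -(sqnormZ hK) /trig scaler_sumr; congr sqnorm.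
  by apply: eq_bigr => i _; rewrite scalerA; congr (_ *: _); ring.
rewrite cintZ; last exact: (continuous_sqnorm_trig hK).
rewrite (eq_bigr (fun i => eps ^+ 2 * (a i * csq (c i)))); last first.
  by move=> i _; rewrite csqM csq_real mulrCA.
by rewrite -mulr_sumr mulrCA ler_pM2l// exprn_gt0.
Qed.

Lemma finite_observability (tau : R) : T < tau -> observable w g a xpredT tau.
Proof.
move=> Ttau; pose m := (Num.truncn (2 * (2 * m0 - l1))).+1.
have hCC : 0 <= 2 * C0 ^+ 2 by apply: mulr_ge0 => //; exact: sqr_ge0.
have hC2 : 0 < 2 * C by rewrite mulr_gt0.
apply: (full_observability hK (b := b) (B := 2 * C0 ^+ 2) (m := m)
  halpha hrho hC2 hT _ _ _ _ upper block_obs _ no_eigen Ttau).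
- exact: hCC.
- by move=> i; rewrite powR_gt0.
- by move=> i; apply: (mulr_ge0 hCC); exact: powR_ge0.
- move=> i; rewrite /b /a norm_freq// [leRHS]mulrCA; apply: (ler_wpM2l hCC).

  by apply: (powR_weight lambda_gt0) => //; apply/ltW/truncnS_gt.
- by apply: freq_discrete => //; case: he => _ [_ []].
Qed.

End Wave.

(** * Modal decomposition of wave solutions *)

Section Oscillator.
Context {R : realType}.
Implicit Types (y : R -> R) (om : R).

(** The energy of the difference with the claimed solution is constant and
    vanishes at time 0. *)
Lemma oscillator y om : 0 < om ->
  (forall t : R, derivable y t 1) -> (forall t : R, derivable (derive1 y) t 1) ->
  (forall t, derive1 (derive1 y) t = - om ^+ 2 * y t) ->
  forall t, y t = y 0 * cos (om * t) + derive1 y 0 / om * sin (om * t) /\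
    derive1 y t = - om * y 0 * sin (om * t) + derive1 y 0 * cos (om * t).
Proof.
move=> om0 dy ddy ode.
have om_neq0 : om != 0 by rewrite gt_eqF.
have Dy t : is_derive t (1 : R) y (derive1 y t).
  by apply: DeriveDef => //; rewrite derive1E.
have Ddy t : is_derive t (1 : R) (derive1 y) (- om ^+ 2 * y t).
  by apply: DeriveDef => //; rewrite -derive1E ode.
pose z t := y t - (y 0 * cos (om * t) + derive1 y 0 / om * sin (om * t)).
pose z' t := derive1 y t - (- om * y 0 * sin (om * t) + derive1 y 0 * cos (om * t)).
pose en t := z' t * z' t + om ^+ 2 * (z t * z t).
have den t : is_derive t (1 : R) en 0.
  have h1 := Dy t; have h2 := Ddy t.
  have h3 := is_derive_cosM om t; have h4 := is_derive_sinM om t.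
  apply: is_derive_eq; rewrite /GRing.scale/= /z /z'; field.
  done.
have en0 t : en t = 0.
  rewrite (is_derive_0_is_cst t 0 den) /en /z /z' !mulr0 cos0 sin0.
  by rewrite !mulr1 !mulr0 addr0 add0r !subrr !mulr0 addr0.
move=> t; have := en0 t; rewrite /en -!expr2.
have zz : 0 <= om ^+ 2 * z t ^+ 2 by apply: mulr_ge0; exact: sqr_ge0.
move/eqP; rewrite (paddr_eq0 (sqr_ge0 _) zz) sqrf_eq0 => /andP[/eqP h1].
rewrite mulf_eq0 (negbTE (expf_neq0 2 om_neq0)) /= sqrf_eq0 => /eqP h2.
by split; apply/eqP; rewrite -subr_eq0; apply/eqP.
Qed.

End Oscillator.

Lemma cvge0_lt (R : realType) (F : set_system R) {FF : Filter F} (f : R -> \bar R)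
    (e : R) :
  f h @[h --> F] --> 0%E -> 0 < e -> \forall h \near F, (f h < e%:E)%E.
Proof.
move=> /fine_cvgP[ffin /cvgrPdist_lt fe] e0.
have := fe e e0; move: ffin; apply: filterS2 => h fh /= hh.
rewrite -(fineK fh) lte_fin; apply: le_lt_trans hh.
by rewrite sub0r normrN ler_norm.
Qed.

Section WaveSolutions.
Context {R : realType} (lambda : nat -> R).
Hypothesis lambda_gt0 : forall n, 0 < lambda n.
Implicit Types (u : R -> nat -> R[i]^o) (s t : R).

(** The norm of D(A^s) controls each coefficient, the weights being positive. *)
Let coef_quotient s u t n (e : R) : derivable_DA lambda s u -> 0 < e ->
  \forall h \near (0 : R)^',
    csq ((h^-1)%:C * (u (t + h) n - u t n) - dt u t n) < e.
Proof.
move=> du e0; have wp : 0 < lambda n `^ (2 * s) by rewrite powR_gt0.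
have H := cvge0_lt (du t) (mulr_gt0 wp e0).
have F0 : Filter (nbhs ((0 : R)^')) by exact: dnbhs_filter.
apply: filterS (H _) => h /=.
move=> /(le_lt_trans (DA_term_le lambda s _ n)).
by rewrite lte_fin ltr_pM2l.
Qed.

Let coef_derivable s u t n : derivable_DA lambda s u ->
  derivable (fun r => Re (u r n)) t 1 /\ derivable (fun r => Im (u r n)) t 1.
Proof.
move=> du.
have key (P : R[i] -> R) : (forall x y z : R[i], forall h : R,
    P (h%:C * (x - y) - z) = h * (P x - P y) - P z) ->
    (forall z, P z ^+ 2 <= csq z) ->
    (fun h => h^-1 *: (P (u (h *: 1 + t) n) - P (u t n))) @ (0 : R)^' --> P (dt u t n).
  move=> Plin Pcsq; apply/cvgrPdist_lt => e e0.
  have := coef_quotient t n du (exprn_gt0 2 e0).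
  apply: filterS => h /= hh.
  rewrite distrC -ltr_sqr ?nnegrE ?(ltW e0)// real_normK ?num_real//.
  rewrite /GRing.scale/= mulr1 -Plin.
  by rewrite [h + t]addrC; exact: le_lt_trans (Pcsq _) hh.
split; apply/cvg_ex; eexists; apply: key => [x y z h|z].
- by rewrite -mulN1r -[- z]mulN1r !(cReD, cReM, cImD, cImM) /=; ring.
- by rewrite lerDl sqr_ge0.
- by rewrite -mulN1r -[- z]mulN1r !(cReD, cReM, cImD, cImM) /=; ring.
- by rewrite lerDr sqr_ge0.
Qed.

(** Each coefficient solves the equation of a harmonic oscillator, whose solutions
    are explicit. *)
Lemma wave_coef s0 (u0 u1 : nat -> R[i]^o) u t n : wave_solution lambda s0 u0 u1 u ->
  let om := Num.sqrt (lambda n) in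
  u t n = (cos (om * t))%:C * u0 n + (sin (om * t) / om)%:C * u1 n /\
  dt u t n = (- om * sin (om * t))%:C * u0 n + (cos (om * t))%:C * u1 n.
Proof.
move=> [hk ode hu0 hu1] om.
have om0 : 0 < om by rewrite sqrtr_gt0.
have omE : om ^+ 2 = lambda n by rewrite sqr_sqrtr// ltW.
have [_ [d1 [_ [d2 _]]]] := hk 2.
have ode' r : dt (dt u) r n = - (om ^+ 2)%:C * u r n.
  have /(congr1 (fun f => f n)) := ode r; rewrite /powA fctE /= powRr1 ?ltW//.
  by move=> /eqP; rewrite addr_eq0 omE mulNr => /eqP.
have Re_ode r : derive1 (derive1 (fun q => Re (u q n))) r = - om ^+ 2 * Re (u r n).
  have := congr1 (@complex.Re R) (ode' r).
  by rewrite -rmorphN cReM /= mul0r subr0.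
have Im_ode r : derive1 (derive1 (fun q => Im (u q n))) r = - om ^+ 2 * Im (u r n).
  have := congr1 (@complex.Im R) (ode' r).
  by rewrite -rmorphN cImM /= mul0r addr0.
have [r1 r2] := oscillator om0 (fun r => (coef_derivable r n d1).1)
  (fun r => (coef_derivable r n d2).1) Re_ode t.
have [i1 i2] := oscillator om0 (fun r => (coef_derivable r n d1).2)
  (fun r => (coef_derivable r n d2).2) Im_ode t.
have e0 : u 0 n = u0 n by rewrite hu0.
have e1 : derive1 (fun q => Re (u q n)) 0 = Re (u1 n) /\
    derive1 (fun q => Im (u q n)) 0 = Im (u1 n) by rewrite -hu1.
case: e1 => e1 e2; rewrite e0 e1 in r1 r2; rewrite e0 e2 in i1 i2.
split; apply: complex_eq.
- by rewrite r1 !(cReD, cReM) /=; ring.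
- by rewrite i1 !(cImD, cImM) /=; ring.
- by rewrite /= r2 !(cReD, cReM) /=; ring.
- by rewrite /= i2 !(cImD, cImM) /=; ring.
Qed.

(** The numbers u_n^+ and u_n^-, according to the direction of rotation. *)
Definition mode (u0 u1 : nat -> R[i]^o) (i : bool * nat) : R[i] :=
  (2^-1)%:C * (u0 i.2 + (0 +i* (- (-1) ^+ i.1 / Num.sqrt (lambda i.2))) * u1 i.2).

Lemma wave_modes s0 (u0 u1 : nat -> R[i]^o) u t n : wave_solution lambda s0 u0 u1 u ->
  u t n = \sum_(s : bool) expi (freq lambda (s, n) * t) * mode u0 u1 (s, n) /\
  dt u t n = \sum_(s : bool) (0 +i* freq lambda (s, n)) *
     (expi (freq lambda (s, n) * t) * mode u0 u1 (s, n)).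
Proof.
move=> hu; have [-> ->] := wave_coef t n hu.
have om0 : Num.sqrt (lambda n) != 0 by rewrite gt_eqF// sqrtr_gt0.
have fT : expi (freq lambda (true, n) * t) = Num.conj (expi (Num.sqrt (lambda n) * t)).
  by rewrite /freq /= expr1 mulN1r mulNr expiN.
have fF : expi (freq lambda (false, n) * t) = expi (Num.sqrt (lambda n) * t).
  by rewrite /freq /= expr0 mul1r.
rewrite !big_bool fT fF /mode /freq /= !expr1 !expr0 !mulN1r !mul1r !opprK.
split; apply: complex_eq;
  rewrite !(cReD, cImD, cReM, cImM, cRe_conj, cIm_conj) /=; by field.
Qed.

Lemma csq_mode_le (u0 u1 : nat -> R[i]^o) i :
  csq (mode u0 u1 i) <= csq (u0 i.2) + (lambda i.2)^-1 * csq (u1 i.2).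
Proof.
rewrite /mode csqM csq_real; apply: (@le_trans _ _ (2^-1 ^+ 2 *
    (2 * csq (u0 i.2) + 2 * ((lambda i.2)^-1 * csq (u1 i.2))))).
  rewrite ler_pM2l ?exprn_gt0 ?invr_gt0//; apply: le_trans (csqD _ _) _.
  rewrite csqM lerD2l ler_pM2l// ler_wpM2r ?csq_ge0//.
  rewrite /csq /= expr0n add0r exprMn sqrrN -exprM mulnC exprM sqrrN expr1n expr1n mul1r.
  by rewrite exprVn sqr_sqrtr// ltW.
have h0 := csq_ge0 (u0 i.2).
have h1 : 0 <= (lambda i.2)^-1 * csq (u1 i.2) by rewrite mulr_ge0 ?csq_ge0// invr_ge0 ltW.
lra.
Qed.

Lemma csq_wave_le s0 (u0 u1 : nat -> R[i]^o) u t n : wave_solution lambda s0 u0 u1 u ->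
  csq (u t n) <= 2 * \sum_(s : bool) csq (mode u0 u1 (s, n)) /\
  csq (dt u t n) <= 2 * lambda n * \sum_(s : bool) csq (mode u0 u1 (s, n)).
Proof.
move=> hu; have [-> ->] := wave_modes t n hu; rewrite !big_bool /=.
have fr (s : bool) : csq (0 +i* freq lambda (s, n)) = lambda n.
  rewrite /csq /= expr0n add0r -real_normK ?num_real// norm_freq//.
  by rewrite sqr_sqrtr// ltW.
split; apply: le_trans (csqD _ _) _; rewrite ?csqM !csq_expi ?fr; lra.
Qed.

End WaveSolutions.

(** * Truncation *)

Section Norm.
Context {R : realType} {V : normedModType R[i]}.
Implicit Types x y : V.

Lemma rnorm_ge0 x : 0 <= rnorm x.
Proof. by rewrite /rnorm; have : 0 <= `|x| by []; rewrite lecE => /andP[]. Qed.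

Lemma rnormD x y : rnorm (x + y) <= rnorm x + rnorm y.
Proof. by rewrite /rnorm -cReD; have := ler_normD x y; rewrite lecE => /andP[]. Qed.

Lemma rnormN x : rnorm (- x) = rnorm x.
Proof. by rewrite /rnorm normrN. Qed.

Lemma rnorm_dist x y : `|rnorm x - rnorm y| <= rnorm (x - y).
Proof.
rewrite ler_norml; apply/andP; split.
  have := rnormD (y - x) x; rewrite subrK -(rnormN (y - x)) opprB; lra.
by have := rnormD (x - y) y; rewrite subrK; lra.
Qed.

End Norm.

Section Density.
Context {R : realType} (lambda : nat -> R).
Hypothesis lambda_gt0 : forall n, 0 < lambda n.
Variables (K : completeNormedModType R[i]) (dotK : {dot K for Num.conj}).
Hypothesis hK : hilbert_norm dotK.
Variables (m0 C0 : R) (L : (nat -> R[i]^o) -> K).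
Hypothesis hL_lin : linear_operator (DA lambda m0) L.
Hypothesis hL_bnd : forall u, DA lambda m0 u -> rnorm (L u) <= C0 * DA_norm lambda m0 u.

Lemma continuous_observation (u : R -> nat -> R[i]^o) : continuous_DA lambda m0 u ->
  continuous (fun t => sqnorm (L (u t))).
Proof.
move=> cu.
have Du t : DA lambda m0 (u t) by case: (cu t).
suff cr : continuous (fun t => rnorm (L (u t))).
  have -> : (fun t => sqnorm (L (u t))) = (fun t => rnorm (L (u t)) * rnorm (L (u t))).
    by apply/funext => t; rewrite /sqnorm expr2.
  pose rho t := rnorm (L (u t)).
  by move=> t; exact: (@continuousM _ _ rho rho t (cr t) (cr t)).
move=> t; apply/cvgrPdist_lt => e e0.
pose d := e ^+ 2 / (C0 ^+ 2 + 1).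
have C1 : 0 < C0 ^+ 2 + 1 by rewrite ltr_wpDl ?sqr_ge0.
have d0 : 0 < d by rewrite divr_gt0 ?exprn_gt0.
have [_ ct] := cu t.
have : \forall h \near (0 : R), (DA_norm2 lambda m0 (u (t + h) - u t)%R < d%:E)%E.
  exact: cvge0_lt ct d0.
move=> /nbhs_ballP[r /= r0 Hr].
apply/nbhs_ballP; exists r => //= s ts.
have /Hr /= : ball (0 : R) r (s - t).
  by move: ts; rewrite /ball/= sub0r opprB.
rewrite [t + (s - t)]addrC subrK => hd.
apply: le_lt_trans (rnorm_dist _ _) _.
have -> : L (u t) - L (u s) = - L (u s - u t).
  have -> : u s - u t = (-1) *: u t + u s by rewrite scaleN1r addrC.
  by rewrite (L_lin hL_lin)// scaleN1r opprD opprK.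
rewrite rnormN -ltr_sqr ?nnegrE ?rnorm_ge0 ?(ltW e0)//.
apply: le_lt_trans (L_bound hL_bnd (ltW hd)) _.
rewrite /d mulrA ltr_pdivrMr// mulrC ltr_pM2l ?exprn_gt0//; lra.
Qed.

Variables (l1 T' C' : R).
Hypothesis hT' : 0 < T'.
Hypothesis hC' : 0 < C'.
Local Notation w := (freq lambda).
Let g (i : bool * nat) : K := L (unit_coef i.2).
Let a (i : bool * nat) : R := lambda i.2 `^ l1.
Hypothesis hobs : forall r (c : bool * nat -> R[i]), uniq r ->
  \sum_(i <- r) a i * csq (c i) <= C' * cint 0 T' (fun t => sqnorm (trig w g r c t)).

Let modes N : seq (bool * nat) := [seq (b, n) | b <- [:: true; false], n <- iota 0 N].

Let uniq_modes N : uniq (modes N).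
Proof. by apply: allpairs_uniq => //; [exact: iota_uniq|move=> [? ?] [? ?] _ _ /= [-> ->]]. Qed.

Let sum_modes (V : nmodType) N (P : pred (bool * nat)) (F : bool * nat -> V) :
  \sum_(i <- modes N | P i) F i = \sum_(n < N) \sum_(s : bool | P (s, nat_of_ord n)) F (s, nat_of_ord n).
Proof.
rewrite big_mkcond /modes big_allpairs_dep /= exchange_big /=.
rewrite -[X in iota 0 X]subn0 -/(index_iota 0 N) big_mkord.
by apply: eq_bigr => n _; rewrite [RHS]big_mkcond big_bool !big_cons big_nil addr0.
Qed.

Let coef_modes N (c : bool * nat -> R[i]) n :
  fin_coef (modes N) snd c n = if (n < N)%N then \sum_(s : bool) c (s, n) else 0.
Proof.
rewrite fin_coefE sum_modes; case: ltnP => nN.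
  rewrite (bigD1 (Ordinal nN))//= [X in _ + X]big1 ?addr0.
    by apply: eq_bigl => s; rewrite eqxx.
  move=> k kn; rewrite big1// => s /eqP /= e.
  by case/negP: kn; apply/eqP/val_inj.
rewrite big1// => k _; rewrite big1// => s /eqP /= e.
by move: nN; rewrite -e leqNgt ltn_ord.
Qed.

(** The observation of the truncated wave is at distance at most C0 times the norm
    of the tail in D(A^m0) from that of the wave, and the modes bound this tail
    uniformly in time.  Factors 2 are harmless, so no convergence of integrals is
    needed: the energy of each truncation is bounded by the observation of a
    longer one, whose tail is arbitrarily small. *)
Lemma observe_wave u0 u1 (u : R -> nat -> R[i]^o) :
  DA lambda m0 u0 -> DA lambda (m0 - 2^-1) u1 ->
  wave_solution lambda (2 * m0) u0 u1 u ->
  forall t, (energy lambda l1 u t <= (4 * C')%:E * observed L T' u)%E.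
Proof.
move=> Du0 Du1 hu t.
have cu : continuous_DA lambda m0 u.
  have [hk _ _ _] := hu; have [c _] := hk 0%N.
  by move: c; rewrite subr0 mulrAC divff// mul1r.
have Du r : DA lambda m0 (u r) by case: (cu r).
pose c := mode lambda u0 u1.
pose phi r := sqnorm (L (u r)).
have cphi : continuous phi by exact: continuous_observation.
have phi0 r : 0 <= phi r by exact: sqnorm_ge0.
have -> : observed L T' u = (cint 0 T' phi)%:E by rewrite -EFin_cint.
set Phi := cint 0 T' phi.
have Phi0 : 0 <= Phi by apply: cint_ge0.
pose h n := lambda n `^ (2 * m0) * \sum_(s : bool) csq (c (s, n)).
have h0 n : 0 <= h n by rewrite mulr_ge0 ?powR_ge0// sumr_ge0// => s _; exact: csq_ge0.
(* partial sums of the square norm of the modes in D(A^m0) *)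
pose H N := \sum_(n < N) h n.
have [S HS] : exists S, forall N, H N <= S.
  exists (2 * (DA_norm lambda m0 u0 ^+ 2 + DA_norm lambda (m0 - 2^-1) u1 ^+ 2)) => N.
  have b0 : \sum_(n < N) lambda n `^ (2 * m0) * csq (u0 n) <= DA_norm lambda m0 u0 ^+ 2.
    by rewrite -lee_fin (DA_norm_sqr Du0) DA_norm2_ge.
  have b1 : \sum_(n < N) lambda n `^ (2 * (m0 - 2^-1)) * csq (u1 n) <=
      DA_norm lambda (m0 - 2^-1) u1 ^+ 2.
    by rewrite -lee_fin (DA_norm_sqr Du1) DA_norm2_ge.
  apply: le_trans (ler_wpM2l (ler0n _ 2) (lerD b0 b1)).
  rewrite -big_split mulr_sumr; apply: ler_sum => n _ /=.
  have l0 := lambda_gt0 n.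
  have -> : lambda n `^ (2 * (m0 - 2^-1)) = lambda n `^ (2 * m0) * (lambda n)^-1.
    rewrite mulrBr mulfV// powRD ?(gt_eqF l0) ?implybT//.
    by rewrite powR_inv1 ?ltW.
  rewrite -mulrA -mulrDr mulrCA ler_wpM2l ?powR_ge0//.
  have := csq_mode_le lambda_gt0 u0 u1 (true, nat_of_ord n).
  have := csq_mode_le lambda_gt0 u0 u1 (false, nat_of_ord n).
  by rewrite big_bool /c /=; lra.
have Hmono N M : (N <= M)%N -> H N <= H M.
  move=> NM; rewrite /H -!(big_mkord xpredT h) [leRHS](big_cat_nat (n := N))//= lerDl.
  exact: sumr_ge0.
pose Hs := sup (range H).
have hasH : has_sup (range H).
  by split; [exists (H 0%N), 0%N|exists S => _ [N _ <-]].
have HHs N : H N <= Hs by apply: sup_upper_bound => //; exists N.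
have tail_small N r : sqnorm (trig w g (modes N) c r) <=
    2 * phi r + 2 * (C0 ^+ 2 * (2 * (Hs - H N))).
  pose f := fin_coef (modes N) snd (fun i => expi (w i * r) * c i).
  have Df : DA lambda m0 f by exact: (DA_fin_coef hL_lin).
  have Lf : L f = trig w g (modes N) c r by exact: (L_fin_coef hL_lin).
  pose v := (-1) *: f + u r.
  have Lv : L v = (-1) *: L f + L (u r) by exact: (L_lin hL_lin).
  have vE n : v n = if (n < N)%N then 0 else u r n.
    have [uE _] := wave_modes lambda_gt0 r n hu.
    rewrite /v scaleN1r; change ((- f n) + u r n = if (n < N)%N then 0 else u r n).
    rewrite /f coef_modes; case: ltnP => _; last by rewrite oppr0 add0r.
    by rewrite uE addNr.
  have hv : (DA_norm2 lambda m0 v <= (2 * (Hs - H N))%:E)%E.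
    apply: DA_norm2_le => M.
    apply: (@le_trans _ _ (2 * (H (maxn N M) - H N))); last first.
      by rewrite ler_pM2l// lerD2r.
    have split_sum : H (maxn N M) - H N = \sum_(N <= n < maxn N M) h n.
      rewrite /H -!(big_mkord xpredT h) (big_cat_nat (n := N) (m := 0%N) (p := maxn N M))//= ?leq_maxl//.
      by rewrite addrAC subrr add0r.
    rewrite split_sum mulr_sumr.
    apply: (@le_trans _ _ (\sum_(n < maxn N M) lambda n `^ (2 * m0) * csq (v n))).
      rewrite -(big_mkord xpredT (fun n => lambda n `^ (2 * m0) * csq (v n))).
      rewrite -(big_mkord xpredT (fun n => lambda n `^ (2 * m0) * csq (v n))).
      rewrite [leRHS](big_cat_nat (n := M))//= ?leq_maxr// lerDl.
      by apply: sumr_ge0 => n _; exact: DA_term_ge0.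
    rewrite -(big_mkord xpredT (fun n => lambda n `^ (2 * m0) * csq (v n))).
    rewrite (big_cat_nat (n := N))//= ?leq_maxl// big_nat big1 ?add0r; last first.
      by move=> n /andP[_ nN]; rewrite vE nN /csq /= expr0n addr0 mulr0.
    rewrite big_nat [leRHS]big_nat; apply: ler_sum => n /andP[Nn _].
    rewrite vE ltnNge Nn /= /h mulrCA ler_wpM2l ?powR_ge0//.
    by have [] := csq_wave_le lambda_gt0 r n hu.
  have -> : trig w g (modes N) c r = L (u r) + (-1) *: L v.
    by rewrite -Lf Lv scalerDr scalerA mulrNN mulr1 scale1r scaleN1r addrCA subrr addr0.
  apply: le_trans (sqnormD hK _ _) _; rewrite lerD2l ler_pM2l// (sqnormZ hK).
  by rewrite csqN1 mul1r (L_bound hL_bnd).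
pose Sa N := \sum_(n < N) \sum_(s : bool) a (s, nat_of_ord n) * csq (c (s, nat_of_ord n)).
have Sa_mono N M : (N <= M)%N -> Sa N <= Sa M.
  move=> NM; rewrite /Sa -!(big_mkord xpredT (fun n => \sum_(s : bool) a (s, n) * csq (c (s, n)))).
  rewrite [leRHS](big_cat_nat (n := N))//= lerDl.
  apply: sumr_ge0 => n _; apply: sumr_ge0 => s _.
  by rewrite mulr_ge0 ?csq_ge0// powR_ge0.
have Sa_le N : Sa N <= 2 * C' * Phi.
  apply/ler_addgt0Pr => eps eps0.
  pose D := C' * (2 * (C0 ^+ 2 * 2) * T') + 1.
  have D0 : 0 < D.
    rewrite ltr_wpDl//; apply: mulr_ge0; first exact: ltW.
    apply: mulr_ge0; last exact: ltW.
    by apply: mulr_ge0 => //; apply: mulr_ge0 => //; exact: sqr_ge0.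
  have ed : 0 < eps / D by rewrite divr_gt0.
  have [_ [M _ <-] hM] := sup_adherent ed hasH.
  rewrite -/Hs in hM.
  pose Q := maxn N M.
  have HQ : Hs - H Q <= eps / D.
    by have := Hmono _ _ (leq_maxr N M); rewrite -/Q; move: hM; lra.
  apply: le_trans (Sa_mono _ _ (leq_maxl N M)) _.
  have := hobs c (uniq_modes Q); rewrite sum_modes -/(Sa Q) => /le_trans; apply.
  have : cint 0 T' (fun r => sqnorm (trig w g (modes Q) c r)) <=
      2 * Phi + 2 * (C0 ^+ 2 * (2 * (eps / D))) * T'.
    apply: (@le_trans _ _ (cint 0 T' (fun r => 2 * phi r + 2 * (C0 ^+ 2 * (2 * (eps / D)))))).
      apply: le_cint => //.
      - exact: (continuous_sqnorm_trig hK).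
      - by apply: continuous_addf; [exact: continuous_scale|exact: cst_continuous].
      move=> r _; apply: le_trans (tail_small _ _) _.
      by rewrite lerD2l ler_pM2l// ler_wpM2l ?sqr_ge0// ler_pM2l.
    rewrite cintD; [|exact: continuous_scale|exact: cst_continuous].
    by rewrite cintZ// cint_cst ?subr0//; exact: ltW.
  move=> /(ler_wpM2l (ltW hC')) /le_trans; apply.
  have -> : C' * (2 * Phi + 2 * (C0 ^+ 2 * (2 * (eps / D))) * T') =
     2 * C' * Phi + (D - 1) * (eps / D) by rewrite /D; ring.
  rewrite lerD2l mulrBl mul1r mulrCA divff ?gt_eqF// mulr1; lra.
have aE n : \sum_(s : bool) a (s, n) * csq (c (s, n)) =
    lambda n `^ l1 * \sum_(s : bool) csq (c (s, n)) by rewrite mulr_sumr.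
have en1 : (DA_norm2 lambda (l1 / 2) (u t) <= (2 * (2 * C' * Phi))%:E)%E.
  apply: DA_norm2_le => N; apply: (@le_trans _ _ (2 * Sa N)); last by rewrite ler_pM2l.
  rewrite mulr_sumr; apply: ler_sum => n _.
  rewrite [2 * (l1 / 2)]mulrCA divff// mulr1 aE [leRHS]mulrCA ler_wpM2l ?powR_ge0//.
  by have [] := csq_wave_le lambda_gt0 t n hu.
have en2 : (DA_norm2 lambda ((l1 - 1) / 2) (dt u t) <= (2 * (2 * C' * Phi))%:E)%E.
  apply: DA_norm2_le => N; apply: (@le_trans _ _ (2 * Sa N)); last by rewrite ler_pM2l.
  rewrite mulr_sumr; apply: ler_sum => n _.
  have l0 := lambda_gt0 n.
  have -> : lambda n `^ (2 * ((l1 - 1) / 2)) = lambda n `^ l1 * (lambda n)^-1.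
    rewrite [2 * (_ / 2)]mulrCA divff// mulr1 powRD ?(gt_eqF l0) ?implybT//.
    by rewrite powR_inv1 ?ltW.
  rewrite aE [leRHS]mulrCA -mulrA ler_wpM2l ?powR_ge0//.
  rewrite ler_pdivrMl// mulrCA mulrA.
  by have [] := csq_wave_le lambda_gt0 t n hu.
rewrite /energy -EFinM.
apply: (@le_trans _ _ ((2^-1)%:E * ((2 * (2 * C' * Phi))%:E + (2 * (2 * C' * Phi))%:E))%E).
  by rewrite lee_wpmul2l ?lee_fin ?invr_ge0//; apply: leeD.
by rewrite -EFinD -EFinM lee_fin; lra.
Qed.

End Density.

Unset Implicit Arguments.
Set Strict Implicit.
Local Close Scope complex_scope.

Theorem theorem3p2 (R : realType)
  (E : completeNormedModType R[i]) (dotE : {dot E for Num.conj})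
  (hE : hilbert_norm dotE)
  (DomA : set E) (A : E -> E)
  (hA_lin : linear_operator DomA A)
  (hA_dense : dense DomA)
  (hA_sa : selfadjoint dotE DomA A)
  (hA_pos : positive_operator dotE DomA A)
  (e : nat -> E) (lambda : nat -> R)
  (he : eigenbasis dotE DomA A e lambda)
  (alpha rho : R) (halpha : 0 < alpha < 1) (hrho : 1 < rho < alpha^-1)
  (K : completeNormedModType R[i]) (dotK : {dot K for Num.conj})
  (hK : hilbert_norm dotK)
  (m0 C0 : R) (L : (nat -> R[i]^o) -> K)
  (hL_lin : linear_operator (DA lambda m0) L)
  (hL_bnd : forall u, DA lambda m0 u -> rnorm (L u) <= C0 * DA_norm lambda m0 u)
  (l1 : R) (hl1 : l1 <= 2 * m0)
  (C : R) (k0 : nat) (T : R) (hC : 0 < C) (hk0 : (0 < k0)%N) (hT : 0 < T)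
  (hobs : forall U : int -> E, dyadic_ball lambda alpha rho e U ->
    forall k : int, k != 0 -> (k0 <= `|k|)%N ->
    forall t : R,
      (energy lambda l1 (half_wave lambda k (coefficients dotE e (U k))) t <=
       C%:E * observed L T (half_wave lambda k (coefficients dotE e (U k))))%E)
  (huc : forall v : E, eigenvector DomA A v -> L (coefficients dotE e v) = 0 -> v = 0) :
  forall T' : R, T < T' ->
  exists C' : R, 0 < C' /\
    forall u0 u1 : nat -> R[i]^o,
      DA lambda m0 u0 -> DA lambda (m0 - 2^-1) u1 ->
    forall u : R -> nat -> R[i]^o,
      wave_solution lambda (2 * m0) u0 u1 u ->
    forall t : R,
      (energy lambda l1 u t <= C'%:E * observed L T' u)%E.
Proof.
have lambda_gt0 n : 0 < lambda n by case: he => _ [h _]; have [] := h n.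
move=> T' TT'.
have [C' C'0 obs] := finite_observability hA_lin he halpha hrho hK hL_lin hL_bnd
  hl1 hC hk0 hT hobs huc TT'.
exists (4 * C'); split; first by rewrite mulr_gt0.
move=> u0 u1 Du0 Du1 u hu t.
apply: (observe_wave lambda_gt0 hK hL_lin hL_bnd (lt_trans hT TT') C'0 _ Du0 Du1 hu).
by move=> r c ur; apply: obs ur _; exact: all_predT.
Qed.
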